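(* Let $K$ be a field, let $\Delta$ be a vertex decomposable simplicial complex with vertex set $\{x_1,\dots,x_n\}$, and let $s_1,\dots,s_n$ be positive integers. Then $\Delta$ is Cohen-Macaulay over $K$ if and only if its $(s_1,\dots,s_n)$-expansion $\Delta^{(s_1,\dots,s_n)}$ is Cohen-Macaulay over $K$.
   Context: Simplicial complexes are finite; $\mathcal{F}(\Delta)$ denotes the set of facets (maximal faces) of $\Delta$, and $[s]=\{1,\dots,s\}$. Expansion: for a simplicial complex $\Delta$ with vertex set $\{x_1,\dots,x_n\}$ and positive integers $s_1,\dots,s_n$, the $(s_1,\dots,s_n)$-expansion $\Delta^{(s_1,\dots,s_n)}$ is the simplicial complex with vertex set $\{x_{11},\dots,x_{1s_1},x_{21},\dots,x_{2s_2},\dots,x_{n1},\dots,x_{ns_n}\}$ whose facets are exactly the sets $\{x_{i_1r_1},\dots,x_{i_kr_k}\}$ where $\{x_{i_1},\dots,x_{i_k}\}\in\mathcal{F}(\Delta)$ with $i_1<\cdots<i_k$ and $(r_1,\dots,r_k)\in[s_{i_1}]\times\cdots\times[s_{i_k}]$. For a face $F\in\Delta$, the link is $\mathrm{lk}_\Delta(F)=\{G\in\Delta: G\cap F=\emptyset,\ G\cup F\in\Delta\}$ and the deletion is $\mathrm{del}_\Delta(F)=\{G\in\Delta: G\cap F=\emptyset\}$; for a vertex $x$ one writes $\mathrm{lk}_\Delta(x)$, $\mathrm{del}_\Delta(x)$ for $F=\{x\}$. Vertex decomposable (recursive definition, non-pure): $\Delta$ is vertex decomposable if $\Delta$ is a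 simplex, or $\Delta$ contains a vertex $x$ such that (i) both $\mathrm{del}_\Delta(x)$ and $\mathrm{lk}_\Delta(x)$ are vertex decomposable, and (ii) every facet of $\mathrm{del}_\Delta(x)$ is a facet of $\Delta$. A simplicial complex is Cohen-Macaulay over $K$ if its Stanley-Reisner ring (the polynomial ring over $K$ on its vertices modulo the Stanley-Reisner ideal, generated by the squarefree monomials of non-faces) is a Cohen-Macaulay ring. *)

(* Defs.v *)
From HB Require Import structures.
From mathcomp Require Import all_boot all_algebra.
From mathcomp Require Import boolp.
From mathcomp.multinomials Require Import mpoly.

Set Implicit Arguments.
Unset Strict Implicit.
Unset Printing Implicit Defensive.

Import GRing.Theory.

Section Complexes.
Local Open Scope nat_scope.
Variable T : finType.

(* A complex always contains the empty face, so the void complex is excluded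
   while {set0} is allowed. Points of T need not be vertices. *)
Record complex := Complex {
  faces :> {set {set T}};
  complex0 : set0 \in faces;
  complexS : forall F G : {set T}, F \in faces -> G \subset F -> G \in faces
}.

Implicit Types (D : {set {set T}}) (F G : {set T}).

Definition vertices D : {set T} := [set x | [set x] \in D].

Definition facets D : {set {set T}} := [set F | maxset (fun G => G \in D) F].

Definition link D F : {set {set T}} :=
  [set G in D | (G :&: F == set0) && (G :|: F \in D)].

Definition deletion D F : {set {set T}} := [set G in D | G :&: F == set0].

(* The simplices are the sets powerset A, including {set0}. *)
Inductive vertex_decomposable : {set {set T}} -> Prop :=
| VD_simplex A : vertex_decomposable (powerset A)
| VD_shedding D x of x \in vertices D
    & vertex_decomposable (deletion D [set x])
    & vertex_decomposable (link D [set x])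
    & facets (deletion D [set x]) \subset facets D :
    vertex_decomposable D.

End Complexes.

Section Expansion.
Variables (T : finType) (D : complex T) (s : T -> nat).

(* The vertex x_(i r) is Tagged _ r, with r : 'I_(s i) numbered from 0. When
   all the s i are positive, as intended, every choice of copies of the points
   of a facet extends to a choice r of copies of all the points of T. *)
Definition expansion_facets : {set {set {i : T & 'I_(s i)}}} :=
  [set G : {set _} | [exists F in facets D,
     exists r : {dffun forall i : T, 'I_(s i)},
     G == [set Tagged (fun i => 'I_(s i)) (r i) | i in F]]].

Definition expansion_faces : {set {set {i : T & 'I_(s i)}}} :=
  [set H : {set _} | [exists G in expansion_facets, H \subset G]].

Hypothesis s_gt0 : forall i, 0 < s i.

Lemma expansion_faces0 : set0 \in expansion_faces.
Proof.
have [F maxF _] := maxset_exists (P := fun G => G \in D) (complex0 D).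
pose r : {dffun forall i : T, 'I_(s i)} := [ffun i => Ordinal (s_gt0 i)].
rewrite inE; apply/existsP.
exists [set Tagged (fun i => 'I_(s i)) (r i) | i in F].
rewrite sub0set andbT inE; apply/existsP; exists F; rewrite inE maxF /=.
by apply/existsP; exists r.
Qed.

Lemma expansion_facesS (F G : {set {i : T & 'I_(s i)}}) :
  F \in expansion_faces -> G \subset F -> G \in expansion_faces.
Proof.
rewrite !inE => /existsP[H /andP[HH FH]] GF; apply/existsP; exists H.
by rewrite HH (subset_trans GF FH).
Qed.

Definition expansion : complex {i : T & 'I_(s i)} :=
  Complex expansion_faces0 expansion_facesS.

End Expansion.

Local Open Scope ring_scope.

Section CohenMacaulay.
Variable R : comNzRingType.
Implicit Types (I J P : R -> Prop) (a x y : R) (xs : seq R).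

Definition subideal I J := forall x, I x -> J x.

Definition ideal I :=
  [/\ I 0, forall x y, I x -> I y -> I (x + y) & forall a x, I x -> I (a * x)].

Definition prime_ideal P :=
  [/\ ideal P, ~ P 1 & forall x y, P (x * y) -> P x \/ P y].

Definition maximal_ideal P :=
  [/\ ideal P, ~ P 1
    & forall J, ideal J -> ~ J 1 -> subideal P J -> subideal J P].

Definition ideal_gen xs : R -> Prop :=
  fun a => exists c : 'I_(size xs) -> R, a = \sum_i c i * xs`_i.

Definition noetherian :=
  forall I, ideal I -> exists xs, forall x, I x <-> ideal_gen xs x.

Definition regular_sequence xs :=
  ~ ideal_gen xs 1 /\
  forall i, (i < size xs)%N ->
    forall a, ideal_gen (take i xs) (a * xs`_i) -> ideal_gen (take i xs) a.

Definition regular_sequence_in P xs :=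
  regular_sequence xs /\ forall x, x \in xs -> P x.

(* C 0 < C 1 < ... < C h = P; the values C i with i > h are irrelevant. *)
Definition prime_chain_to P (h : nat) (C : nat -> R -> Prop) :=
  [/\ forall i, (i <= h)%N -> prime_ideal (C i),
      forall i, (i < h)%N ->
        subideal (C i) (C i.+1) /\ ~ subideal (C i.+1) (C i)
    & forall x, C h x <-> P x].

Definition height_is P (h : nat) :=
  (exists C, prime_chain_to P h C) /\
  (forall k C, prime_chain_to P k C -> (k <= h)%N).

Definition depth_is P (d : nat) :=
  (exists2 xs, regular_sequence_in P xs & size xs = d) /\
  (forall xs, regular_sequence_in P xs -> (size xs <= d)%N).

(* The definition of Eisenbud and of Kaplansky. For a maximal ideal P of a
   noetherian ring R, the height of P is the Krull dimension of the local ring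
   R_P and the maximal length of a regular sequence in P is the depth of R_P,
   so this says that all the localizations R_P are Cohen-Macaulay. *)
Definition cohen_macaulay :=
  noetherian /\
  forall P, maximal_ideal P -> exists d, depth_is P d /\ height_is P d.

End CohenMacaulay.

Section StanleyReisner.
Variables (K : fieldType) (T : finType) (D : complex T).

(* The variables are indexed by T through enum_rank. *)
Definition face_monomial (F : {set T}) : {mpoly K[#|T|]} :=
  \prod_(x in F) 'X_(enum_rank x).

Definition SR_ideal : {pred {mpoly K[#|T|]}} :=
  fun p => asbool (ideal_gen [seq face_monomial F | F in ~: faces D] p).

Lemma SR_idealP p :
  reflect (ideal_gen [seq face_monomial F | F in ~: faces D] p)
          (p \in SR_ideal).
Proof. exact: asboolP. Qed.

Lemma SR_ideal_closed : idealr_closed SR_ideal.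
Proof.
split.
- apply/SR_idealP; exists (fun=> 0).
  by rewrite big1 // => i _; rewrite mul0r.
- apply/SR_idealP => -[c /(congr1 (meval (fun=> 0)))].
  rewrite rmorph1 raddf_sum big1 => [/eqP|i _]; first by rewrite oner_eq0.
  set f := _`_i; have : f \in [seq face_monomial F | F in ~: faces D].
    exact: mem_nth.
  case/imageP => F; rewrite inE => FD ->.
  have /set0Pn[x xF] : F != set0 by apply: contraNneq FD => ->; apply: complex0.
  by rewrite /= mevalM /face_monomial (bigD1 x) //= mevalM mevalXU mul0r mulr0.
- move=> a u v /SR_idealP[c ->] /SR_idealP[d ->]; apply/SR_idealP.
  exists (fun i => a * c i + d i); rewrite mulr_sumr -big_split /=.
  by apply: eq_bigr => i _; rewrite mulrDl mulrA.
Qed.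

HB.instance Definition _ :=
  isIdealr.Build {mpoly K[#|T|]} SR_ideal SR_ideal_closed.

Definition SR_ring : comNzRingType := {ideal_quot SR_ideal}.

Definition cohen_macaulay_over := cohen_macaulay SR_ring.

End StanleyReisner.

(* Main.v *)
From HB Require Import structures.
Require Import Defs.
From mathcomp Require Import all_boot all_algebra.
From mathcomp Require Import boolp ring zify.
From mathcomp.multinomials Require Import mpoly.

(* Both sides are equivalent to D being pure.

   A regular sequence in a prime P of a noetherian ring yields, above any
   prime annihilating an element that survives in the localization at P, a
   chain of primes ending at P whose length is that of the sequence. In the
   Stanley-Reisner ring, a chain of primes is no longer than the number of
   variables outside its first prime, and these variables form a face. At the
   irrelevant maximal ideal, whose height is at least the size of any facet,
   starting the chain at the prime of a facet bounds the depth by the size of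
   that facet; hence a Cohen-Macaulay complex is pure.

   Conversely, let D be pure of facet size d and let P be a maximal ideal. By
   Zariski's lemma every variable x satisfies a monic equation h_x(x) = 0
   modulo P. The d elementary symmetric functions of the x h_x(x) lie in P and
   form a regular sequence: this holds on a simplex, and it passes from the
   link and the deletion of a vertex x to the complex by the exact sequence
   0 -> S/(I : x) -> S/I -> S/(I + x) -> 0. The same recursion, one copy of a
   shedding vertex at a time, runs through the expansion, which is therefore
   treated together with D. *)

Set Implicit Arguments.
Unset Strict Implicit.
Unset Printing Implicit Defensive.

Import GRing.Theory.
Local Open Scope ring_scope.

(** * Ideals and regular sequences *)

Section Ideals.
Variable R : comNzRingType.
Implicit Types (I J P : R -> Prop) (a x y : R) (xs : seq R).

Definition zero_ideal : R -> Prop := fun y => y = 0.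

Definition add_principal I x : R -> Prop :=
  fun y => exists i c, I i /\ y = i + c * x.

Definition colon I x : R -> Prop := fun y => I (y * x).

(** For a prime [P], the contraction to [R] of the extension of [I] to the localization at [P]; it
    replaces computations with fractions. *)
Definition saturation P I : R -> Prop := fun y => exists2 s, ~ P s & I (s * y).

(** Regularity modulo [I] without the demand that the ideal stay proper, so that inductions may run
    into the unit ideal. *)
Fixpoint weakly_regular I xs : Prop :=
  if xs is x :: xs' then
    (forall a, I (a * x) -> I a) /\ weakly_regular (add_principal I x) xs'
  else True.

Lemma eq_ideal I J : subideal I J -> subideal J I -> I = J.
Proof. by move=> IJ JI; apply/funext => y; apply/propext; split; [apply: IJ|apply: JI]. Qed.

Section OneIdeal.
Variables (I : R -> Prop) (hI : ideal I).

Lemma ideal0 : I 0. Proof. by case: hI. Qed.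
Lemma idealD x y : I x -> I y -> I (x + y). Proof. by case: hI => _ + _; apply. Qed.
Lemma ideal_mull a x : I x -> I (a * x). Proof. by case: hI => _ _; apply. Qed.
Lemma ideal_mulr a x : I x -> I (x * a). Proof. by rewrite mulrC; apply: ideal_mull. Qed.
Lemma idealN x : I x -> I (- x). Proof. by rewrite -mulN1r; apply: ideal_mull. Qed.
Lemma idealB x y : I x -> I y -> I (x - y).
Proof. by move=> Ix /idealN; apply: idealD. Qed.
Lemma idealDr x y : I y -> I (x + y) -> I x.
Proof. by move=> Iy /idealB/(_ Iy); rewrite addrK. Qed.

Lemma ideal_sum (J : Type) (r : seq J) (Q : pred J) (F : J -> R) :
  (forall j, Q j -> I (F j)) -> I (\sum_(j <- r | Q j) F j).
Proof. by move=> IF; elim/big_ind: _ => //; [apply: ideal0|apply: idealD]. Qed.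

Lemma ideal_add_principal x : ideal (add_principal I x).
Proof.
split; first by exists 0, 0; rewrite mul0r addr0; split => //; apply: ideal0.
  move=> _ _ [i [c [Ii ->]]] [j [d [Ij ->]]]; exists (i + j), (c + d).
  by split; [apply: idealD|ring].
move=> a _ [i [c [Ii ->]]]; exists (a * i), (a * c).
by split; [apply: ideal_mull|ring].
Qed.

Lemma sub_add_principal x : subideal I (add_principal I x).
Proof. by move=> i Ii; exists i, 0; rewrite mul0r addr0. Qed.

Lemma mem_add_principal x : add_principal I x x.
Proof. by exists 0, 1; rewrite mul1r add0r; split=> //; apply: ideal0. Qed.

Lemma add_principal_min J x :
  ideal J -> subideal I J -> J x -> subideal (add_principal I x) J.
Proof.
move=> hJ IJ Jx _ [i [c [/IJ Ji ->]]].
by case: hJ => _ JD JM; apply: JD => //; apply: JM.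
Qed.

Lemma ideal_colon x : ideal (colon I x).
Proof.
rewrite /colon; split; first by rewrite mul0r; apply: ideal0.
  by move=> y z; rewrite mulrDl; apply: idealD.
by move=> a y; rewrite -mulrA; apply: ideal_mull.
Qed.

Section Saturation.
Variables (P : R -> Prop) (hP : prime_ideal P).

Lemma prime_compl x y : ~ P x -> ~ P y -> ~ P (x * y).
Proof. by case: hP => _ _ PM Px Py /PM[]. Qed.

Lemma prime_compl1 : ~ P 1. Proof. by case: hP. Qed.

Lemma sub_saturation : subideal I (saturation P I).
Proof. by move=> y Iy; exists 1; [apply: prime_compl1|rewrite mul1r]. Qed.

Lemma ideal_saturation : ideal (saturation P I).
Proof.
split; first exact/sub_saturation/ideal0.
  move=> x y [s Ps Isx] [t Pt Ity]; exists (s * t); first exact: prime_compl.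
  have -> : s * t * (x + y) = t * (s * x) + s * (t * y) by ring.
  by apply: idealD; apply: ideal_mull.
move=> a x [s Ps Isx]; exists s => //.
by rewrite mulrCA; apply: ideal_mull.
Qed.

Lemma saturationMr s x : ~ P s -> saturation P I (s * x) -> saturation P I x.
Proof.
move=> Ps [t Pt Itsx]; exists (t * s); first exact: prime_compl.
by rewrite -mulrA.
Qed.

End Saturation.
End OneIdeal.

Lemma add_principalC I x y :
  add_principal (add_principal I x) y = add_principal (add_principal I y) x.
Proof.
have sub u v : subideal (add_principal (add_principal I u) v)
                        (add_principal (add_principal I v) u).
  move=> _ [_ [c [[i [d [Ii ->]]] ->]]]; exists (i + c * v), d.
  by split; [exists i, c|ring].
exact: eq_ideal.
Qed.

Lemma weakly_regular1 I xs : ideal I -> I 1 -> weakly_regular I xs.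
Proof.
elim: xs I => //= x xs IH I hI I1; split.
  by move=> a _; rewrite -[a]mulr1; apply: ideal_mull.
by apply: IH; [apply: ideal_add_principal|apply: sub_add_principal].
Qed.

(* The exact sequence 0 -> R/(I : x) -> R/I -> R/(I + x) -> 0 in terms of
   ideals. *)
Lemma weakly_regular_colon I x xs : ideal I ->
  weakly_regular (colon I x) xs -> weakly_regular (add_principal I x) xs ->
  weakly_regular I xs.
Proof.
elim: xs I => //= t xs IH I hI [regC IHC] [regA IHA].
have lift a : add_principal I x (a * t) ->
    exists i b, I i /\ a = i + b * x.
  by move/regA => [i [b [Ii ->]]]; exists i, b.
split.
  move=> a Iat; have [i [b [Ii ai]]] := lift a (sub_add_principal x Iat).
  rewrite ai; apply: idealD => //; apply: regC; rewrite /colon.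
  have -> : b * t * x = a * t - i * t by rewrite ai; ring.
  by apply: idealB => //; apply: ideal_mulr.
apply: IH; first exact: ideal_add_principal.
(* The exact sequence survives modulo [t]: if [y * x = i + c * t], regularity of [t] modulo [I + x]
   makes [c] a multiple of [x] modulo [I], and [y] can be corrected by a multiple of [t]. *)
- suff -> : colon (add_principal I t) x = add_principal (colon I x) t by [].
  apply: eq_ideal => y.
    move=> [i [c [Ii yx]]].
    have [] := lift c.
      exists (- i), y; split; first exact: idealN.
      by rewrite yx; ring.
    move=> j [b [Ij cE]]; exists (y - b * t), b; split; last by ring.
    rewrite /colon.
    have -> : (y - b * t) * x = i + t * j by rewrite mulrBl yx cE; ring.
    by apply: idealD => //; apply: ideal_mull.
  move=> [i [c [Ii ->]]]; exists (i * x), (c * x); split => //; ring.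
- by rewrite add_principalC.
Qed.

(** The exact sequence for [a] modulo [I + ab]: since [a] is regular modulo [I], the colon ideal is
    [I + b], while adding [a] gives [I + a]. *)
Lemma weakly_regular_mul I a b xs : ideal I ->
  (forall y, I (y * a) -> I y) ->
  weakly_regular (add_principal I a) xs -> weakly_regular (add_principal I b) xs ->
  weakly_regular (add_principal I (a * b)) xs.
Proof.
move=> hI rega wa wb; apply: (@weakly_regular_colon _ a).
- exact: ideal_add_principal.
- suff -> : colon (add_principal I (a * b)) a = add_principal I b by [].
  apply: eq_ideal => y.
    move=> [i [c [Ii ya]]]; exists (y - c * b), c; split; last by ring.
    apply: rega; have -> : (y - c * b) * a = i by rewrite mulrBl ya; ring.
    by [].
  by move=> [i [c [Ii ->]]]; exists (i * a), c; split; [apply: ideal_mulr|ring].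
- suff -> : add_principal (add_principal I (a * b)) a = add_principal I a by [].
  apply: eq_ideal.
    apply: add_principal_min; [exact: ideal_add_principal| |].
      apply: add_principal_min; [exact: ideal_add_principal| |].
        exact: sub_add_principal.
      by apply: ideal_mulr; [exact: ideal_add_principal|exact: mem_add_principal].
    exact: mem_add_principal.
  move=> _ [i [c [Ii ->]]]; exists i, c; split=> //.
  exact: sub_add_principal.
Qed.

Lemma regular_prod I (J : Type) (r : seq J) (Q : pred J) (F : J -> R) :
  (forall j y, Q j -> I (y * F j) -> I y) ->
  forall y, I (y * \prod_(j <- r | Q j) F j) -> I y.
Proof.
move=> regF y; elim: r y => [|j r IH] y; first by rewrite big_nil mulr1.
rewrite big_cons; case: ifP => // Qj; last exact: IH.
by rewrite mulrA => /IH/(regF _ _ Qj).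
Qed.

Lemma weakly_regular_prod I (J : Type) (r : seq J) (Q : pred J) (F : J -> R) xs :
  ideal I -> (forall j y, Q j -> I (y * F j) -> I y) ->
  (forall j, Q j -> weakly_regular (add_principal I (F j)) xs) ->
  weakly_regular (add_principal I (\prod_(j <- r | Q j) F j)) xs.
Proof.
move=> hI regF wF; elim: r => [|j r IH].
  (* The empty product generates the unit ideal, modulo which every sequence is weakly regular. *)
  rewrite big_nil; apply: weakly_regular1; first exact: ideal_add_principal.
  exact: mem_add_principal.
rewrite big_cons; case: ifP => // Qj.
by apply: weakly_regular_mul => //; [move=> y; apply: regF|apply: wF].
Qed.

Lemma ideal_zero : ideal zero_ideal.
Proof.
by split=> // [x y -> ->|a x ->]; rewrite /zero_ideal ?addr0 ?mulr0.
Qed.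

Lemma weakly_regularE I xs :
  weakly_regular I xs <->
  forall i, (i < size xs)%N -> forall a,
    foldl add_principal I (take i xs) (a * xs`_i) ->
    foldl add_principal I (take i xs) a.
Proof.
elim: xs I => [|x xs IH] I /=; first by [].
split=> [[regx /IH w] [|i] //= ltin a|reg].
  by apply: w.
split; first by move=> a; apply: (reg 0%N).
by apply/IH => i lti a; apply: (reg i.+1).
Qed.

Lemma foldl_add_principalP I xs y : ideal I ->
  foldl add_principal I xs y <-> exists2 i, I i & ideal_gen xs (y - i).
Proof.
elim: xs I y => [|x xs IH] I y hI /=.
  split=> [Iy|[i Ii [c /=]]]; last by rewrite big_ord0 => /subr0_eq ->.
  by exists y => //; exists (fun=> 0); rewrite subrr big_ord0.
split.
  case/IH; first exact: ideal_add_principal.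
  move=> _ [i [c [Ii ->]]] [d yE]; exists i => //.
  exists (fun j => if unlift ord0 j is Some j' then d j' else c).
  rewrite big_ord_recl unlift_none /=.
  under eq_bigr do rewrite liftK /=.
  by rewrite -yE; ring.
case=> i Ii [c]; rewrite big_ord_recl /= => yE.
apply/IH; first exact: ideal_add_principal.
exists (i + c ord0 * x); first by exists i, (c ord0).
exists (fun j => c (lift ord0 j)).
by rewrite opprD addrA yE addrC addKr.
Qed.

Lemma ideal_genE xs : ideal_gen xs = foldl add_principal zero_ideal xs.
Proof.
apply: eq_ideal => y.
  move=> gy; apply/(foldl_add_principalP _ _ ideal_zero); exists 0 => //.
  by rewrite subr0.
by move/(foldl_add_principalP _ _ ideal_zero) => [_ ->]; rewrite subr0.
Qed.

Lemma ideal_foldl I xs : ideal I -> ideal (foldl add_principal I xs).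
Proof. by elim: xs I => //= x xs IH I hI; apply/IH/ideal_add_principal. Qed.

Lemma ideal_ideal_gen xs : ideal (ideal_gen xs).
Proof. rewrite ideal_genE; exact/ideal_foldl/ideal_zero. Qed.

Lemma mem_ideal_gen xs x : x \in xs -> ideal_gen xs x.
Proof.
move=> xin; have ltx : (index x xs < size xs)%N by rewrite index_mem.
exists (fun j => if j == Ordinal ltx then 1 else 0).
rewrite (bigD1 (Ordinal ltx)) //= eqxx mul1r nth_index // big1 ?addr0 //.
by move=> j /negbTE ->; rewrite mul0r.
Qed.

Lemma ideal_gen_min I xs :
  ideal I -> (forall x, x \in xs -> I x) -> subideal (ideal_gen xs) I.
Proof.
move=> hI xsI _ [c ->]; apply: ideal_sum => // i _.
by apply: ideal_mull => //; apply/xsI/mem_nth.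
Qed.

Lemma regular_sequenceE xs :
  regular_sequence xs <->
  ~ ideal_gen xs 1 /\ weakly_regular zero_ideal xs.
Proof.
rewrite weakly_regularE; split=> -[n1 reg]; split=> // i lti a;
  by move: (reg i lti a); rewrite !ideal_genE.
Qed.

Lemma maximal_prime P : maximal_ideal P -> prime_ideal P.
Proof.
move=> [hP P1 maxP]; split=> // x y Pxy.
have [Px|nPx] := pselect (P x); [by left|right].
have [z [c [Pz E]]] : add_principal P x 1.
  apply: contrapT => n1; apply: nPx.
  apply: (maxP (add_principal P x)) => //.
  - exact: ideal_add_principal.
  - exact: sub_add_principal.
  - exact: mem_add_principal.
have -> : y = z * y + c * (x * y) by rewrite mulrA -mulrDl -E mul1r.
by apply: idealD => //; [apply: ideal_mulr|apply: ideal_mull].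
Qed.

Section Noetherian.
Hypothesis noethR : noetherian R.

(** Without a maximal member, choice produces a strictly ascending chain in [F]. Its union is
    finitely generated, and the generators already lie in one term. *)
Lemma maximal_exists (F : (R -> Prop) -> Prop) I0 :
  F I0 -> (forall I, F I -> ideal I) ->
  exists I, F I /\ forall J, F J -> subideal I J -> subideal J I.
Proof.
move=> FI0 idF; apply: contrapT => nmax.
have step (I : {I | F I}) : exists J : {J | F J},
    subideal (sval I) (sval J) /\ ~ subideal (sval J) (sval I).
  apply: contrapT => nJ; apply: nmax; exists (sval I); split; first exact: svalP.
  move=> J FJ IJ; apply: contrapT => nJI; apply: nJ.
  by exists (exist _ J FJ).
have [next nextP] := choice step.
pose C k := sval (iter k next (exist _ I0 FI0)).
have idC k : ideal (C k) by apply/idF/svalP.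
have CS k : subideal (C k) (C k.+1) by have [] := nextP (iter k next (exist _ I0 FI0)).
have Cmono k l : (k <= l)%N -> subideal (C k) (C l).
  move=> /subnK <-; elim: (l - k)%N => // m IH y /IH.
  by rewrite addSn; apply: CS.
pose U := fun y => exists k, C k y.
have idU : ideal U.
  split; first by exists 0%N; apply: ideal0.
    move=> x y [k kx] [l ly]; exists (maxn k l); apply: idealD => //.
      by apply: Cmono kx; apply: leq_maxl.
    by apply: Cmono ly; apply: leq_maxr.
  by move=> a x [k kx]; exists k; apply: ideal_mull.
have [xs xsU] := noethR idU.
have [k kxs] : exists k, forall x, x \in xs -> C k x.
  have: forall x, x \in xs -> U x by move=> x /mem_ideal_gen/xsU.
  elim: xs {xsU} => [|x xs IH] xsU; first by exists 0%N.
  have [|k kxs] := IH; first by move=> y yxs; apply: xsU; rewrite inE yxs orbT.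
  have [l lx] := xsU x (mem_head _ _).
  exists (maxn k l) => y; rewrite inE => /orP[/eqP->|/kxs].
    by apply: Cmono lx; apply: leq_maxr.
  by apply: Cmono; apply: leq_maxl.
have [_] := nextP (iter k next (exist _ I0 FI0)); apply => y yC.
apply: (ideal_gen_min (idC k) kxs); apply/xsU.
by exists k.+1.
Qed.

(** * Prime chains from regular sequences *)

Section RegularChain.
Variables (P : R -> Prop) (hP : prime_ideal P).

Local Notation sat := (saturation P).

Let idP : ideal P. Proof. by case: hP. Qed.

Lemma colon_saturation_sub I a :
  ideal I -> ~ sat I a -> subideal (colon (sat I) a) P.
Proof.
move=> hI na y ya; apply: contrapT => nPy; apply: na.
exact: (saturationMr hP nPy).
Qed.

(** Existence of associated primes: among the annihilators, above the given one, of elements that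
    are nonzero in the localization modulo [I], a maximal one is prime. *)
Lemma prime_colon_exists I a : ideal I -> ~ sat I a ->
  exists c, [/\ ~ sat I c, prime_ideal (colon (sat I) c)
    & subideal (colon (sat I) a) (colon (sat I) c)].
Proof.
move=> hI na; have hs := ideal_saturation hI hP.
pose F J := exists c, [/\ ~ sat I c, J = colon (sat I) c
  & subideal (colon (sat I) a) J].
have [||J [[c [nc -> ac]] maxc]] := @maximal_exists F (colon (sat I) a).
- by exists a; split.
- by move=> _ [c [_ -> _]]; apply: ideal_colon.
exists c; split => //; split; first exact: ideal_colon.
  by rewrite /colon mul1r.
move=> x y xyc; have [|nyc] := pselect (sat I (y * c)); [by right|left].
apply: (maxc (colon (sat I) (y * c))).
- exists (y * c); split=> // z /ac; rewrite /colon => zc.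
  by rewrite mulrCA; apply: ideal_mull.
- move=> z; rewrite /colon => zc; rewrite mulrCA; exact: ideal_mull.
- by rewrite /colon mulrA.
Qed.

(* Nakayama's lemma for J / sat I with J = (sat I : p), localized at P: if J
   were contained in sat (I + x), then J = sat I + x J locally. *)
Lemma colon_not_sub I p c x : ideal I -> (forall a, I (a * x) -> I a) -> P x ->
  ~ sat I c -> p = colon (sat I) c ->
  exists a, ~ sat (add_principal I x) a /\ forall y, p y -> sat I (y * a).
Proof.
move=> hI regx Px nc pE; have hs := ideal_saturation hI hP.
apply: contrapT => nex.
pose F J := exists a, [/\ ~ sat I a, J = sat (add_principal I a)
  & forall y, p y -> sat I (y * a)].
have [||J [[a [na -> pa]] maxa]] := @maximal_exists F (sat (add_principal I c)).
- by exists c; split=> //; rewrite pE.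
- move=> _ [a [_ -> _]]; apply: ideal_saturation => //.
  exact: ideal_add_principal.
(* If the claim fails, [a] is locally [b * x] modulo [I]. As [x] is regular, [b] is again
   annihilated by [p], and maximality forces [b] into the saturation of [I + a]. *)
have [s Ps [i [b [Ii sa]]]] : sat (add_principal I x) a.
  by apply: contrapT => na'; apply: nex; exists a.
have pb y : p y -> sat I (y * b).
  move=> /pa[t Pt tya]; exists t => //.
  apply: regx.
  have -> : t * (y * b) * x = s * (t * (y * a)) - t * y * i.
    have -> : s * (t * (y * a)) = t * y * (s * a) by ring.
    by rewrite sa; ring.
  by apply: idealB => //; apply: ideal_mull.
have nb : ~ sat I b.
  move=> sb; apply: na; apply: (saturationMr hP Ps); rewrite sa.
  by apply: (idealD hs); [apply: sub_saturation|apply: ideal_mulr].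
have [|||s' Ps' [j [d [Ij E]]]] := maxa (sat (add_principal I b)) _ _ b.
- by exists b; split.
- move=> y [t Pt [j [d [Ij E]]]]; exists (t * s); first exact: prime_compl.
  exists (s * j + d * i), (d * x); split.
    by apply: (idealD hI); apply: ideal_mull.
  have -> : t * s * y = s * (t * y) by ring.
  by rewrite E mulrDr (mulrCA s d a) sa; ring.
- exact: (sub_saturation hP (mem_add_principal hI _)).
(* Nakayama's unit: [x] lies in [P], so [s * s' - d * x] does not, and it carries [b] into [I]. *)
apply: nb; exists (s * s' - d * x).
  move=> Pss; apply: (prime_compl hP Ps Ps').
  by rewrite -(subrK (d * x) (s * s')); apply: idealD => //; apply: ideal_mull.
have -> : (s * s' - d * x) * b = s * j + d * i.
  rewrite mulrBl -mulrA E mulrDr (mulrCA s d a) sa; ring.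
by apply: idealD => //; apply: ideal_mull.
Qed.

(** The chain is built from below. An associated prime above the annihilator of [a] is put first;
    [colon_not_sub] gives [b] that survives modulo [I + x] and is annihilated by this prime, and the
    rest of the sequence is treated with [I + x] and [b]. *)
Lemma regular_chain I xs a : ideal I -> weakly_regular I xs ->
  (forall x, x \in xs -> P x) -> ~ sat I a ->
  exists C, prime_chain_to P (size xs) C /\ subideal (colon (sat I) a) (C 0%N).
Proof.
elim: xs I a => [|x xs IH] I a hI /=.
  move=> _ _ na; exists (fun=> P); split; last exact: colon_saturation_sub.
  by split.
move=> [regx wxs] xsP na; have hs := ideal_saturation hI hP.
have [c [nc primec ac]] := prime_colon_exists hI na.
have Px : P x by apply: xsP; apply: mem_head.
have [b [nb pb]] := colon_not_sub hI regx Px nc erefl.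
have hIx := ideal_add_principal hI x.
have [||C [[Cprime Cstrict CP] bC]] := IH _ b hIx wxs.
- by move=> y yxs; apply: xsP; rewrite inE yxs orbT.
- exact: nb.
have cC : subideal (colon (sat I) c) (C 0%N).
  move=> y yc; apply: bC; have [s Ps E] := pb y yc.
  by exists s => //; apply: sub_add_principal.
exists (fun i => if i is j.+1 then C j else colon (sat I) c); split => //.
split=> [[|i]//|[|i]|//]; [exact: Cprime| |exact: Cstrict].
(* The first inclusion is strict because [x] annihilates [b] modulo [I + x], whereas it is regular
   modulo [I] and cannot annihilate [c]. *)
move=> _; split=> // Cc; apply: nc.
have [|s Ps E] := Cc x.
  apply: bC; apply: sub_saturation => //; apply: ideal_mulr => //.
  exact: mem_add_principal.
by exists s => //; apply: regx; rewrite -mulrA (mulrC c).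
Qed.

End RegularChain.
End Noetherian.
End Ideals.

(** * Ideals and chains under surjective homomorphisms *)

Section Preimage.
Variables (R S : comNzRingType) (f : {rmorphism R -> S}).
Hypothesis f_surj : forall y, exists x, f x = y.

Definition preimage (I : S -> Prop) : R -> Prop := fun x => I (f x).

Lemma ideal_preimage I : ideal I -> ideal (preimage I).
Proof.
move=> hI; rewrite /preimage; split; first by rewrite rmorph0; apply: ideal0.
  by move=> x y; rewrite rmorphD; apply: idealD.
by move=> a x; rewrite rmorphM; apply: ideal_mull.
Qed.

Lemma prime_preimage I : prime_ideal I -> prime_ideal (preimage I).
Proof.
move=> [hI I1 IM]; split; rewrite /preimage ?rmorph1 //.
  exact: ideal_preimage.
by move=> x y; rewrite rmorphM; apply: IM.
Qed.

Lemma preimage_chain P h C :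
  prime_chain_to P h C ->
  prime_chain_to (preimage P) h (fun i => preimage (C i)).
Proof.
move=> [Cprime Cstrict CP]; split=> [i lti|i lti|x]; last exact: CP.
  exact/prime_preimage/Cprime.
have [sub nsub] := Cstrict i lti; split; first by move=> x; apply: sub.
move=> sub'; apply: nsub => y; have [x <-] := f_surj y; exact: sub'.
Qed.

Lemma preimage_add_principal I x : ideal I ->
  preimage (add_principal I (f x)) = add_principal (preimage I) x.
Proof.
move=> hI; apply: eq_ideal => y.
  move=> [i [c [Ii E]]]; have [d dc] := f_surj c.
  exists (y - d * x), d; split; last by ring.
  by rewrite /preimage rmorphB rmorphM E dc addrK.
move=> [i [c [Ii ->]]]; exists (f i), (f c); split=> //.
by rewrite rmorphD rmorphM.
Qed.

Lemma weakly_regular_map I xs : ideal I ->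
  weakly_regular (preimage I) xs -> weakly_regular I (map f xs).
Proof.
elim: xs I => //= x xs IH I hI [reg wxs]; split.
  move=> b; have [a <-] := f_surj b; rewrite -rmorphM; exact: reg.
apply: IH; first exact: ideal_add_principal.
by rewrite preimage_add_principal.
Qed.

Lemma noetherian_surj : noetherian R -> noetherian S.
Proof.
move=> nR I hI; have [xs xsI] := nR _ (ideal_preimage hI).
exists (map f xs) => y; split.
  have [x <-] := f_surj y; move/xsI => [c ->].
  rewrite rmorph_sum; apply: ideal_sum; first exact: ideal_ideal_gen.
  move=> i _; rewrite rmorphM; apply: ideal_mull; first exact: ideal_ideal_gen.
  by apply: mem_ideal_gen; apply/map_f/mem_nth.
apply: ideal_gen_min => // _ /mapP[x /mem_ideal_gen/xsI xI ->]; exact: xI.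
Qed.

End Preimage.

(** * Noetherian rings *)

Section Hilbert.
Variable R : comNzRingType.
Hypothesis noethR : noetherian R.

Lemma ideal_gen_cat (S : comNzRingType) (xs ys : seq S) :
  subideal (ideal_gen xs) (ideal_gen (xs ++ ys)) /\
  subideal (ideal_gen ys) (ideal_gen (xs ++ ys)).
Proof.
by split; apply: ideal_gen_min; do ?exact: ideal_ideal_gen;
  move=> x xin; apply: mem_ideal_gen; rewrite mem_cat xin ?orbT.
Qed.

Section OneIdeal.
Variables (I : {poly R} -> Prop) (hI : ideal I).

Let lead k c := exists2 p, I p & (size p <= k.+1)%N /\ p`_k = c.

Let ideal_lead k : ideal (lead k).
Proof.
split; first by exists 0; rewrite ?size_poly0 ?coef0 //; apply: ideal0.
  move=> _ _ [p Ip [sp <-]] [q Iq [sq <-]]; exists (p + q).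
    exact: idealD.
  rewrite coefD; split => //; apply: leq_trans (size_polyD _ _) _.
  by rewrite geq_max sp.
move=> a _ [p Ip [sp <-]]; exists (a%:P * p); first exact: ideal_mull.
by rewrite coefCM mul_polyC; split => //; apply: leq_trans (size_scale_leq _ _) sp.
Qed.

(** One polynomial for each generator of [lead k], added to the generators for smaller degrees,
    clears the coefficient of degree [k]. *)
Let low_degree_gen k : exists ps, (forall p, p \in ps -> I p) /\
  forall p, I p -> (size p <= k)%N -> ideal_gen ps p.
Proof.
elim: k => [|k [ps [psI IHps]]].
  exists [::]; split=> // p _; rewrite leqn0 size_poly_eq0 => /eqP ->.
  exact: (ideal0 (ideal_ideal_gen _)).
have [cs csL] := noethR (ideal_lead k).
have [g gP] : exists g : R -> {poly R}, forall c, lead k c ->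
    [/\ I (g c), (size (g c) <= k.+1)%N & (g c)`_k = c].
  have /choice[g gP] c : exists p, lead k c ->
    [/\ I p, (size p <= k.+1)%N & p`_k = c].
    have [[p Ip [sp pc]]|nL] := pselect (lead k c); first by exists p.
    (* A default value outside [lead k]; only the values at generators of [lead k] matter. *)
    by exists 0.
  by exists g.
have {}gP c : c \in cs -> [/\ I (g c), (size (g c) <= k.+1)%N & (g c)`_k = c].
  by move=> /mem_ideal_gen/csL/gP.
exists (map g cs ++ ps); split.
  by move=> p; rewrite mem_cat => /orP[/mapP[c /gP[Igc _ _] ->]|/psI].
have [sub1 sub2] := ideal_gen_cat (map g cs) ps.
move=> p Ip sp; have [d pk] : ideal_gen cs p`_k by apply/csL; exists p.
set q := \sum_i (d i)%:P * g cs`_i.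
have gq : ideal_gen (map g cs) q.
  apply: ideal_sum => [|i _]; first exact: ideal_ideal_gen.
  apply: ideal_mull; first exact: ideal_ideal_gen.
  by apply/mem_ideal_gen/map_f/mem_nth.
have Iq : I q by apply: ideal_gen_min gq => // _ /mapP[c /gP[Igc _ _] ->].
rewrite -(subrK q p); apply: idealD; [exact: ideal_ideal_gen| |exact: sub1].
apply/sub2/IHps; first exact: idealB.
apply/leq_sizeP => j; rewrite leq_eqVlt coefB => /orP[/eqP <-|ltkj].
  apply/eqP; rewrite subr_eq0 pk coef_sum; apply/eqP/eq_bigr => i _.
  by rewrite coefCM; have [|_ _ ->] := gP cs`_i; first exact: mem_nth.
rewrite (leq_sizeP _ _ sp) // coef_sum big1 ?subr0 // => i _.
have [|_ sg _] := gP cs`_i; first exact: mem_nth.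
by rewrite coefCM (leq_sizeP _ _ sg) ?mulr0.
Qed.

(** Hilbert's argument: polynomials realizing generators of the ideal of all leading coefficients
    lower every degree from [N] on, and [low_degree_gen] covers the degrees below [N]. *)
Lemma poly_ideal_fg : exists ps, forall p, I p <-> ideal_gen ps p.
Proof.
pose L c := exists k, lead k c.
have hL : ideal L.
  split; first by exists 0%N; exact: (ideal0 (ideal_lead _)).
    have shift k l c : lead k c -> lead (k + l) c.
      move=> [p Ip [sp <-]]; exists (p * 'X^l); first exact: ideal_mulr.
      rewrite coefMXn ltnNge leq_addl addnK /=; split => //.
      by apply: leq_trans (size_polyMleq _ _) _; rewrite size_polyXn addnS /= -addSn leq_add2r.
    move=> x y [k kx] [l ly]; exists (k + l)%N.
    by apply: idealD; [exact: ideal_lead|exact: shift|rewrite addnC; exact: shift].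
  by move=> a x [k kx]; exists k; apply: ideal_mull; first exact: ideal_lead.
have [cs csL] := noethR hL.
have [g gP] : exists g : R -> nat * {poly R}, forall c, L c ->
    [/\ I (g c).2, (size (g c).2 <= (g c).1.+1)%N & (g c).2`_(g c).1 = c].
  have /choice[g gP] c : exists p : nat * {poly R}, L c ->
    [/\ I p.2, (size p.2 <= p.1.+1)%N & p.2`_p.1 = c].
    have [[k [p Ip [sp pc]]]|nL] := pselect (L c); first by exists (k, p).
    by exists (0%N, 0).
  by exists g.
have {}gP c : c \in cs ->
    [/\ I (g c).2, (size (g c).2 <= (g c).1.+1)%N & (g c).2`_(g c).1 = c].
  by move=> /mem_ideal_gen/csL/gP.
pose N := \max_(c <- cs) (g c).1.
have leN c : c \in cs -> ((g c).1 <= N)%N by move=> cin; rewrite (leq_bigmax_seq (F := fun c => (g c).1)).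
have [ps [psI psP]] := low_degree_gen N.
exists (map (fun c => (g c).2) cs ++ ps) => p; split; last first.
  apply: ideal_gen_min => // q.
  by rewrite mem_cat => /orP[/mapP[c /gP[Igc _ _] ->]|/psI].
have [sub1 sub2] := ideal_gen_cat (map (fun c => (g c).2) cs) ps.
have [m] := ubnP (size p); elim: m p => // m IHm p; rewrite ltnS => sp Ip.
have [leps|ltsp] := leqP (size p) N; first exact/sub2/psP.
case: m sp IHm => [|m sp IHm]; first by move/leq_trans/(_ (leq0n N)); rewrite leqNgt ltsp.
have leNm : (N <= m)%N by rewrite -ltnS; apply: leq_trans sp.
have [d pk] : ideal_gen cs p`_m by apply/csL; exists m, p.
(* The powers of ['X] shift the chosen polynomials to the common degree [m], where [q] then has the
   same coefficient as [p]. *)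
set q := \sum_i (d i)%:P * ((g cs`_i).2 * 'X^(m - (g cs`_i).1)).
have gq : ideal_gen (map (fun c => (g c).2) cs) q.
  apply: ideal_sum => [|i _]; first exact: ideal_ideal_gen.
  apply: ideal_mull; first exact: ideal_ideal_gen.
  apply: ideal_mulr; first exact: ideal_ideal_gen.
  by apply/mem_ideal_gen/(map_f (fun c => (g c).2))/mem_nth.
have Iq : I q by apply: ideal_gen_min gq => // _ /mapP[c /gP[Igc _ _] ->].
rewrite -(subrK q p); apply: idealD; [exact: ideal_ideal_gen| |exact: sub1].
apply: IHm; last exact: idealB.
rewrite ltnS; apply/leq_sizeP => j; rewrite leq_eqVlt coefB => /orP[/eqP <-|ltkj].
  apply/eqP; rewrite subr_eq0 pk coef_sum; apply/eqP/eq_bigr => i _.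
  have cin : cs`_i \in cs by exact: mem_nth.
  rewrite coefCM coefMXn ltnNge leq_subr subKn /= ?(leq_trans (leN _ cin)) //.
  by have [_ _ ->] := gP _ cin.
rewrite (leq_sizeP _ _ sp) // coef_sum big1 ?subr0 // => i _.
have cin : cs`_i \in cs by exact: mem_nth.
have [_ sg _] := gP _ cin; have leg := leq_trans (leN _ cin) leNm.
rewrite coefCM coefMXn (leq_sizeP _ _ sg) ?if_same ?mulr0 //.
by rewrite ltn_subRL subnK.
Qed.

End OneIdeal.

Theorem hilbert_basis : noetherian {poly R}.
Proof. exact: poly_ideal_fg. Qed.

End Hilbert.

(** * Finitely generated extensions *)

Section Adjunction.
Variable L : comNzRingType.

Section OneElement.
Variables (R : comNzRingType) (f : {rmorphism R -> L}) (x : L).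

Definition adjoin : {poly R} -> L := horner_morph (fun a => mulrC x (f a)).
HB.instance Definition _ := GRing.RMorphism.on adjoin.

Lemma adjoinE p : adjoin p = (map_poly f p).[x]. Proof. by []. Qed.
Lemma adjoinC a : adjoin a%:P = f a. Proof. exact: horner_morphC. Qed.
Lemma adjoinX : adjoin 'X = x. Proof. exact: horner_morphX. Qed.

End OneElement.

(** The subring generated by [xs] over the image of [f]. The entries are adjoined one at a time
    while the base ring grows to iterated polynomial rings, so that an induction on [xs] passes
    through all intermediate rings. *)
Fixpoint generated (xs : seq L) : forall R : comNzRingType, {rmorphism R -> L} -> L -> Prop :=
  if xs is x :: xs' then fun R f => generated xs' (adjoin f x : {rmorphism _ -> _})
  else fun R f y => exists a, f a = y.

Lemma generated_base xs (R : comNzRingType) (f : {rmorphism R -> L}) a : generated xs f (f a).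
Proof.
elim: xs R f a => [|x xs IH] R f a /=; first by exists a.
by rewrite -(adjoinC f x); apply: IH.
Qed.

Lemma generated_mem xs (R : comNzRingType) (f : {rmorphism R -> L}) x :
  x \in xs -> generated xs f x.
Proof.
elim: xs R f => //= y xs IH R f; rewrite inE => /orP[/eqP->|/IH //].
  by have := generated_base xs (adjoin f y) 'X; rewrite [X in generated _ _ X]adjoinX.
Qed.

Lemma generatedD xs (R : comNzRingType) (f : {rmorphism R -> L}) x y :
  generated xs f x -> generated xs f y -> generated xs f (x + y).
Proof.
elim: xs R f => [|z xs IH] R f /=; last exact: IH.
by move=> [a <-] [b <-]; exists (a + b); rewrite rmorphD.
Qed.

Lemma generatedM xs (R : comNzRingType) (f : {rmorphism R -> L}) x y :
  generated xs f x -> generated xs f y -> generated xs f (x * y).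
Proof.
elim: xs R f => [|z xs IH] R f /=; last exact: IH.
by move=> [a <-] [b <-]; exists (a * b); rewrite rmorphM.
Qed.

Lemma noetherian_generated xs (R : comNzRingType) (f : {rmorphism R -> L}) :
  noetherian R -> (forall y, generated xs f y) -> noetherian L.
Proof.
elim: xs R f => [|x xs IH] R f nR /= gen; first exact: (noetherian_surj gen).
exact: IH (hilbert_basis nR) gen.
Qed.

End Adjunction.

Lemma noetherian_field (K : fieldType) : noetherian K.
Proof.
move=> I hI; have [[x Ix /eqP x0]|n] := pselect (exists2 x, I x & x <> 0).
  exists [:: 1] => y; split=> _; first by exists (fun=> y); rewrite big_ord1 mulr1.
  by rewrite -[y](mulfVK x0) mulrC; apply: ideal_mulr.
exists [::] => y; split=> [Iy|[c ->]]; last by rewrite big_ord0; apply: ideal0.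
by exists (fun=> 0); rewrite big_ord0; apply: contrapT => y0; apply: n; exists y.
Qed.

Section MpolyGenerated.
Variables (K : fieldType) (n : nat) (L : comNzRingType).
Variable f : {rmorphism {mpoly K[n]} -> L}.

(** Serves twice: with the identity for the noetherian property, and with the map to a residue field
    for Zariski's lemma. *)
Lemma mpoly_generated (g : {rmorphism K -> L}) xs :
  (forall c, g c = f c%:MP) -> (forall i, f 'X_i \in xs) ->
  forall p, generated xs g (f p).
Proof.
move=> gE fX p; rewrite (mpolyE p) rmorph_sum.
have g0 : generated xs g 0 by rewrite -(rmorph0 g); apply: generated_base.
have g1 : generated xs g 1 by rewrite -(rmorph1 g); apply: generated_base.
elim/big_ind: _ => [//|x y|m _]; first exact: generatedD.
rewrite -mul_mpolyC rmorphM; apply: generatedM.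
  by rewrite -gE; apply: generated_base.
rewrite mpolyXE_id rmorph_prod; elim/big_ind: _ => [//|x y|i _]; first exact: generatedM.
rewrite rmorphXn; elim: (m i) => [|k IH]; first by rewrite expr0.
by rewrite exprS; apply: generatedM => //; apply/generated_mem/fX.
Qed.

End MpolyGenerated.

Lemma noetherian_mpoly (K : fieldType) n : noetherian {mpoly K[n]}.
Proof.
pose xs := [seq 'X_i : {mpoly K[n]} | i <- enum 'I_n].
apply: (@noetherian_generated _ xs _ (@mpolyC n K)); first exact: noetherian_field.
move=> p; apply: (mpoly_generated (f := idfun)) => // i.
by apply/mapP; exists i; rewrite ?mem_enum.
Qed.

(** * The residue field of a maximal ideal *)

Section ResidueField.
Local Open Scope quotient_scope.
Variables (R : comNzRingType) (P : R -> Prop).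

(** The maximality proof is an argument so that the ideal structure, which needs a proper ideal, can
    be attached to the predicate. *)
Definition residue_pred of maximal_ideal P : {pred R} := fun x => asbool (P x).

Variable maxP : maximal_ideal P.
Local Notation PP := (residue_pred maxP).

Let PPE x : x \in PP <-> P x.
Proof. by split; move/asboolP. Qed.

Lemma residue_pred_closed : idealr_closed PP.
Proof.
have [hP P1 _] := maxP; split; first exact/PPE/(ideal0 hP).
  by apply/negP => /PPE.
move=> a u v /PPE Pu /PPE Pv; apply/PPE; apply: idealD => //.
exact: ideal_mull.
Qed.

HB.instance Definition _ := isIdealr.Build R PP residue_pred_closed.

Definition residue_ring : comNzRingType := {ideal_quot PP}.
Definition residue_map : {rmorphism R -> residue_ring} := \pi_residue_ring.

Lemma residue_map_surj y : exists x, residue_map x = y.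
Proof. by elim/quotW: y => x; exists x. Qed.

Lemma residue_map_eq0 x : residue_map x = 0 <-> P x.
Proof.
rewrite -(rmorph0 residue_map).
rewrite -[x in P x]subr0 -PPE Quotient.idealrBE.
by split=> /eqP.
Qed.

Definition residue_inv (y : residue_ring) : residue_ring :=
  if pselect (exists z, z * y = 1) is left h then sval (cid h) else 0.

Lemma residue_mulVf y : y != 0 -> residue_inv y * y = 1.
Proof.
rewrite /residue_inv; case: pselect => [h|n] y0; first exact: (svalP (cid h)).
case: n; have [hP P1 maxPP] := maxP; have [x xy] := residue_map_surj y.
have [i [c [Pi E]]] : add_principal P x 1.
  apply: contrapT => n1; apply: (elimN eqP y0); rewrite -xy; apply/residue_map_eq0.
  apply: (maxPP _ (ideal_add_principal hP x) n1); first exact: sub_add_principal.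
  exact: mem_add_principal.
exists (residue_map c); rewrite -xy -rmorphM; apply/eqP; rewrite eq_sym -subr_eq0.
by rewrite -(rmorph1 residue_map) -rmorphB E addrK; apply/eqP/residue_map_eq0.
Qed.

Lemma residue_inv0 : residue_inv 0 = 0.
Proof.
rewrite /residue_inv; case: pselect => // h; exfalso; case: h => z.
by rewrite mulr0 => /eqP; rewrite eq_sym oner_eq0.
Qed.

Definition residue_field : Type := residue_ring.
HB.instance Definition _ := GRing.ComNzRing.on residue_field.
HB.instance Definition _ :=
  GRing.ComNzRing_isField.Build residue_field residue_mulVf residue_inv0.

Lemma residue_field_exists : exists (L : fieldType) (f : {rmorphism R -> L}),
  (forall y, exists x, f x = y) /\ (forall x, f x = 0 <-> P x).
Proof.
exists residue_field, residue_map.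
by split; [exact: residue_map_surj|exact: residue_map_eq0].
Qed.

End ResidueField.

(** * Zariski's lemma *)

(* Kaplansky's proof of Zariski's lemma. *)
Section Zariski.
Variable L : fieldType.

(* The image of f becomes a field after inverting one nonzero element. *)
Definition goldman (R : comNzRingType) (f : {rmorphism R -> L}) :=
  exists2 c, f c != 0 &
    forall a, f a != 0 -> exists N b, f c ^+ N = f b * f a.

Definition algebraic_in (R : comNzRingType) (f : {rmorphism R -> L}) x :=
  exists2 p, map_poly f p != 0 & root (map_poly f p) x.

Section OneStep.
Variables (R : comNzRingType) (f : {rmorphism R -> L}).

(** If [x] were transcendental, [1 + q * 'X] would divide a power of [q] as a polynomial. It is
    coprime to all these powers and not constant. *)
Lemma goldman_adjoin_algebraic x : goldman (adjoin f x) -> algebraic_in f x.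
Proof.
move=> [q q0 gold]; apply: contrapT => nalg.
have trans p : adjoin f x p = 0 -> map_poly f p = 0.
  move=> p0; apply/eqP; apply: contrapT => /negP np; apply: nalg.
  by exists p => //; apply/rootP.
pose h := 1 + q * 'X.
have fhE : map_poly f h = 1 + map_poly f q * 'X.
  by rewrite rmorphD rmorphM rmorph1 /= map_polyX.
have q'0 : map_poly f q != 0.
  by apply: contraNneq q0; rewrite /= adjoinE => ->; rewrite horner0.
have sh : size (map_poly f h) = (size (map_poly f q)).+1.
  by rewrite fhE addrC size_polyDl ?size_mulX // size_poly1 ltnS size_poly_gt0.
have [|N [z E]] := gold h.
  by apply/eqP => /trans fh0; move: sh; rewrite fh0 size_poly0.
have {}E : map_poly f q ^+ N = map_poly f z * map_poly f h.
  rewrite -rmorphXn -rmorphM; apply/eqP; rewrite -subr_eq0 -rmorphB.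
  by apply/eqP/trans; rewrite rmorphB rmorphXn rmorphM E subrr.
have cop : coprimep (map_poly f h) (map_poly f q ^+ N).
  apply/coprimep_expr/Bezout_coprimepP; exists (1, - 'X) => /=.
  by rewrite fhE mulNr mul1r [_ * 'X]mulrC addrK eqpxx.
move: cop; rewrite E coprimepMr coprimepp sh eqSS size_poly_eq0 (negbTE q'0).
by rewrite andbF.
Qed.

(** When [f c] is nonzero, this is integrality over the image of [R] with [f c] inverted, written
    without denominators. *)
Definition almost_integral c u := exists N, integralOver f (f c ^+ N * u).

Lemma integralX c u N : integralOver f u -> integralOver f (f c ^+ N * u).
Proof. by move=> iu; rewrite -rmorphXn; apply: integral_mul => //; apply: integral_id. Qed.

Lemma almost_integral_mulr c u d v : almost_integral c u -> almost_integral d v ->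
  almost_integral (c * d) (u * v).
Proof.
move=> [M iu] [N iv]; exists (M + N)%N; rewrite rmorphM exprMn !exprD.
have -> : f c ^+ M * f c ^+ N * (f d ^+ M * f d ^+ N) * (u * v) =
  (f d ^+ M * (f c ^+ M * u)) * (f c ^+ N * (f d ^+ N * v)) by ring.
by apply: integral_mul; apply: integralX.
Qed.

Lemma almost_integral_id c a : almost_integral c (f a).
Proof. by exists 0%N; rewrite mul1r; apply: integral_id. Qed.

Lemma almost_integralM c u v :
  almost_integral c u -> almost_integral c v -> almost_integral c (u * v).
Proof.
move=> [M iu] [N iv]; exists (M + N)%N; rewrite exprD mulrACA.
exact: integral_mul.
Qed.

Lemma almost_integralD c u v :
  almost_integral c u -> almost_integral c v -> almost_integral c (u + v).
Proof.
move=> [M iu] [N iv]; exists (M + N)%N; rewrite mulrDr.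
apply: integral_add; first by rewrite addnC exprD -mulrA; apply: integralX.
by rewrite exprD -mulrA; apply: integralX.
Qed.

Lemma almost_integral_adjoin c x p : almost_integral c x ->
  almost_integral c (adjoin f x p).
Proof.
move=> ix; elim/poly_ind: p => [|p a IH].
  by rewrite rmorph0 -(rmorph0 f); apply: almost_integral_id.
rewrite rmorphD rmorphM /= adjoinX adjoinC.
by apply: almost_integralD; [exact: almost_integralM|exact: almost_integral_id].
Qed.

(** Multiplying the equation of [x] by a power of its leading coefficient [a] turns it into a monic
    equation of [a * x], given by [s] below. *)
Lemma integral_lead_coef x : algebraic_in f x ->
  exists2 a, f a != 0 & integralOver f (f a * x).
Proof.
move=> [p p0 /rootP px]; set n := (size (map_poly f p)).-1.
have sp : size (map_poly f p) = n.+1 by rewrite prednK ?size_poly_gt0.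
exists p`_n; first by rewrite -coef_map -lead_coefE lead_coef_eq0.
case: n sp => [|n] sp.
  have [c c0 pE] : exists2 c, c != 0 & map_poly f p = c%:P.
    by apply/size_poly1P; rewrite sp.
  by move: px; rewrite pE hornerC => /eqP; rewrite (negbTE c0).
set a := f p`_n.+1.
pose s := 'X^(n.+1) + \poly_(i < n.+1) (f p`_i * a ^+ (n - i)).
have mon_s : s \is monic.
  rewrite monicE /s lead_coefDl ?lead_coefXn // size_polyXn ltnS.
  exact: size_poly.
apply: (integral_root_monic mon_s).
  apply/rootP; rewrite hornerD hornerXn horner_poly.
  have: a ^+ n * (map_poly f p).[x] = 0 by rewrite px mulr0.
  rewrite horner_coef sp big_ord_recr /= coef_map /= -/a mulrDr addrC => E.
  rewrite -[RHS]E exprMn exprS; congr (_ + _); first by rewrite !mulrA [_ * a]mulrC.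
  rewrite mulr_sumr; apply: eq_bigr => i _; rewrite coef_map /=.
  have -> : a ^+ n = a ^+ (n - i) * a ^+ i by rewrite -exprD subnK // -ltnS.
  by rewrite exprMn; ring.
apply/integral_poly => i; rewrite coefD coefXn coef_poly; apply: integral_add.
  exact: integral_nat.
case: ifP => _; last exact: integral0.
by rewrite /a -rmorphXn -rmorphM; apply: integral_id.
Qed.

(** Dividing the monic equation of [v] by [v] writes the constant term times the inverse of [v] as a
    polynomial in [v]. A vanishing constant term is removed first, by lowering the degree. *)
Lemma integral_inv_numerator v : v != 0 -> integralOver f v ->
  exists2 d, f d != 0 & integralOver f (f d * v^-1).
Proof.
move=> v0 [p mon_p]; move: (mon_p); have [m] := ubnP (size p).
elim: m p mon_p => // m IH p; rewrite ltnS => mon_p sp _.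
elim/poly_ind: p mon_p sp => [|p a _] mon_p sp; first by rewrite monicE lead_coef0 eq_sym oner_eq0 in mon_p.
rewrite rmorphD rmorphM /= map_polyX map_polyC /= => /rootP.
rewrite !hornerE => E.
have [p0|p0] := eqVneq p 0.
  move: E; rewrite p0 rmorph0 horner0 mul0r add0r => fa0.
  move: mon_p; rewrite p0 mul0r add0r monicE lead_coefC => /eqP a1.
  by move/eqP: fa0; rewrite a1 rmorph1 oner_eq0.
have mon : p \is monic.
  move: mon_p; rewrite !monicE lead_coefDl ?lead_coefMX //.
  by rewrite size_mulX // ltnS (leq_trans (size_polyC_leq1 _)) // size_poly_gt0.
have sp' : (size p < m)%N.
  apply: leq_trans sp; rewrite size_polyDl ?size_mulX //.
  by rewrite ltnS (leq_trans (size_polyC_leq1 _)) // size_poly_gt0.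
have [fa0|fa0] := eqVneq (f a) 0.
  apply: (IH p) => //; apply/rootP; apply: (mulIf v0).
  by rewrite mul0r -[RHS]E fa0 addr0.
exists a => //; have -> : f a * v^-1 = - (map_poly f p).[v].
  by apply: (mulIf v0); rewrite mulfVK //; apply/eqP; rewrite mulNr -addr_eq0 addrC E.
apply/integral_opp/integral_horner; last first.
  by exists ('X * p + a%:P); rewrite mulrC // rmorphD rmorphM /= map_polyX map_polyC /=;
    apply/rootP; rewrite !hornerE.
by apply/integral_poly => i; rewrite coef_map; apply: integral_id.
Qed.

End OneStep.

(** After inverting a suitable [c], both [x] and the inverse of [g] are integral. Hence so is the
    inverse of every nonzero [f y], and an element whose inverse is integral over a ring containing
    it is a unit of that ring. *)
Lemma goldman_adjoin (R : comNzRingType) (f : {rmorphism R -> L}) x :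
  goldman (adjoin f x) -> goldman f.
Proof.
move=> gold; have [a a0 iax] := integral_lead_coef (goldman_adjoin_algebraic gold).
have {gold} [q q0 gold] := gold; set g := adjoin f x q in q0 *.
have aix : almost_integral f a x by exists 1%N.
have [k ig] : almost_integral f a g by apply: almost_integral_adjoin.
have [|d d0 id] := integral_inv_numerator _ ig.
  by rewrite mulf_neq0 // expf_neq0.
have aig : almost_integral f d g^-1.
  exists 1%N; move/(integralX a k): id; congr integralOver.
  by rewrite expr1 invfM mulrCA; congr (_ * _); rewrite mulVKf // expf_neq0.
(* The factor [a] serves for [x], the factor [d] for the inverse of [g]. *)
pose c := a * d; have c0 : f c != 0 by rewrite rmorphM mulf_neq0.
have one e : almost_integral f e 1 by rewrite -(rmorph1 f); apply: almost_integral_id.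
have cix : almost_integral f c x by rewrite -[x]mulr1; apply: almost_integral_mulr.
have cig : almost_integral f c g^-1 by rewrite -[_^-1]mul1r; apply: almost_integral_mulr.
exists c => // y y0; have [|N [b E]] := gold y%:P; first by rewrite /= adjoinC.
have [M [r mon_r /rootP ru]] : almost_integral f c (f y)^-1.
  have -> : (f y)^-1 = adjoin f x b * g^-1 ^+ N.
    apply: (mulfI y0); rewrite mulfV // exprVn mulrA [f y * _]mulrC.
    by rewrite -[f y](adjoinC f x) -E mulfV // expf_neq0.
  apply: almost_integralM; first exact: almost_integral_adjoin.
  elim: (N) => [|n IH]; first exact: one.
  by rewrite exprS; apply: almost_integralM.
set u := f c ^+ M * _ in ru.
have uy : u * f y = f c ^+ M by rewrite /u mulfVK.
have u0 : u != 0 by rewrite mulf_neq0 ?expf_neq0 ?invr_eq0.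
have mon_fr : map_poly f r \is monic by apply: monic_map.
case sr: (size (map_poly f r)) => [|[|n]].
- by move: mon_fr; rewrite monicE lead_coefE sr nth_default ?sr // eq_sym oner_eq0.
- move: mon_fr ru; rewrite monicE lead_coefE sr horner_coef sr big_ord1 /= => /eqP->.
  by rewrite mul1r => /eqP; rewrite oner_eq0.
(* The monic equation of [u], of degree [n.+1], is multiplied by [f y ^+ n.+1]. Since
   [u * f y = f c ^+ M], its leading term becomes a power of [f c], and a factor [f y] remains in
   all other terms. *)
exists (M * n.+2.-1)%N, (- \sum_(i < n.+1) r`_i * (y ^+ (n - i) * c ^+ (M * i))).
have lead1 : (map_poly f r)`_n.+1 = 1.
  by move/eqP: mon_fr; rewrite lead_coefE sr.
have: f y ^+ n.+1 * (map_poly f r).[u] = 0 by rewrite ru mulr0.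
rewrite horner_coef sr big_ord_recr /= lead1 mul1r mulrDr -exprMn.
rewrite [f y * u]mulrC uy -exprM => /eqP; rewrite addrC addr_eq0 => /eqP ->.
rewrite rmorphN mulNr rmorph_sum mulr_suml mulr_sumr; congr (- _).
apply: eq_bigr => i _; rewrite coef_map /= !rmorphM !rmorphXn exprM -uy [(u * f y) ^+ i]exprMn.
have -> : f y ^+ n.+1 = f y ^+ (n - i) * f y ^+ i * f y.
  by rewrite -exprD subnK -?exprSr // -ltnS.
by ring.
Qed.

(** With all generators adjoined the image is the field [L], where [c = 1] works; [goldman_adjoin]
    then removes one generator at a time. *)
Lemma generated_goldman xs (R : comNzRingType) (f : {rmorphism R -> L}) :
  (forall y, generated xs f y) -> goldman f.
Proof.
elim: xs R f => [|x xs IH] R f /= gen; last exact/(goldman_adjoin (x := x))/IH.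
exists 1; first by rewrite rmorph1 oner_eq0.
move=> a a0; exists 0%N; have [b bE] := gen (f a)^-1.
by exists b; rewrite bE mulVf.
Qed.

(** As [x] is adjoined first, the descent along the other generators ends at [K[x]], and there the
    Goldman condition makes [x] algebraic. *)
Theorem zariski (K : fieldType) (f : {rmorphism K -> L}) x xs :
  (forall y, generated (x :: xs) f y) -> integralOver f x.
Proof.
move=> /= /generated_goldman/goldman_adjoin_algebraic [p p0 px].
by apply/integral_algebraic; exists p; rewrite // -(map_poly_eq0 f).
Qed.

End Zariski.

(** * Prime chains in polynomial rings *)

Section PowerProducts.
Variables (K : fieldType) (S : comNzRingType) (g : {rmorphism K -> S}) (N : nat).

(** Nested pairs, so that an induction on [h] can split off the exponent of [a 0]. *)
Fixpoint exponents h : finType :=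
  if h is h'.+1 then ('I_N * exponents h')%type else unit.

Lemma card_exponents h : #|exponents h| = (N ^ h)%N.
Proof. by elim: h => [|h IH]; rewrite ?card_unit //= card_prod card_ord IH expnS. Qed.

Fixpoint power_product (a : nat -> S) h : exponents h -> S :=
  if h is h'.+1 then fun e => a 0%N ^+ e.1 * power_product (fun i => a i.+1) e.2
  else fun=> 1.

(* The lexicographically least term of a polynomial relation between
   a_0, ..., a_{h-1} would be nonzero modulo C 0. *)
Lemma power_product_free h (C : nat -> S -> Prop) (a : nat -> S) :
  (forall i, (i <= h)%N -> prime_ideal (C i)) ->
  (forall i, (i < h)%N -> [/\ subideal (C i) (C i.+1), C i.+1 (a i) & ~ C i (a i)]) ->
  forall c : exponents h -> K,
  C 0%N (\sum_e g (c e) * power_product a e) -> forall e, c e = 0.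
Proof.
elim: h C a => [|h IH] C a Cprime Cstrict c.
  rewrite (big_pred1 tt) /=; last by case.
  move=> C0 [] /=; apply/eqP; apply: contrapT => /negP c0.
  have [hC C1 _] := Cprime 0%N isT; apply: C1.
  rewrite -(rmorph1 g) -(mulVf c0) rmorphM -[g (c tt)]mulr1.
  exact: ideal_mull.
have [hC0 _ CM0] := Cprime 0%N isT; have [hC1 _ _] := Cprime 1%N isT.
have [C01 C1a C0a] := Cstrict 0%N isT.
pose b j := \sum_e g (c (j, e)) * power_product (fun i => a i.+1) e.
have -> : \sum_(e : exponents h.+1) g (c e) * power_product a e =
          \sum_(j < N) a 0%N ^+ j * b j.
  rewrite [LHS](eq_bigr (fun p : 'I_N * exponents h => a 0%N ^+ p.1 *
    (g (c (p.1, p.2)) * power_product (fun i => a i.+1) p.2))); last first.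
    by move=> [j e] _ /=; rewrite mulrCA.
  rewrite -(pair_bigA _ (fun (j : 'I_N) e => a 0%N ^+ j *
    (g (c (j, e)) * power_product (fun i => a i.+1) e))).
  by apply: eq_bigr => j _; rewrite mulr_sumr.
move=> sumC.
suff b0 j e : c (j, e) = 0 by move=> [j e].
have [m] := ubnP j; elim: m j e => // m IHm j e; rewrite ltnS => lejm.
(* It suffices that [b j] lies in [C 1]: the induction hypothesis then applies to the chain and the
   elements shifted by one. *)
apply: (IH (fun i => C i.+1) (fun i => a i.+1)) (fun e => c (j, e)) _ e.
- by move=> i lti; apply: Cprime.
- by move=> i lti; apply: Cstrict.
rewrite -/(b j).
pose r := \sum_(k < N | (j < k)%N) a 0%N ^+ (k - j.+1) * b k.
(* The coefficients with first exponent below [j] are already known to vanish, so [a 0 ^+ j] can be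
   factored out. *)
have sumE : \sum_(k < N) a 0%N ^+ k * b k = a 0%N ^+ j * (b j + a 0%N * r).
  rewrite (bigID (fun k : 'I_N => (k < j)%N)) /= big1 ?add0r; last first.
    move=> k ltkj; rewrite /b big1 ?mulr0 // => e' _.
    by rewrite IHm ?rmorph0 ?mul0r //; apply: leq_trans ltkj lejm.
  rewrite (bigD1 j) ?ltnn //= mulrDr; congr (_ + _).
  rewrite /r mulr_sumr mulr_sumr; apply: eq_big => [k|k].
    by rewrite -leqNgt eq_sym ltn_neqAle andbC.
  rewrite -leqNgt => /andP[lejk nkj].
  have ltjk : (j < k)%N by rewrite ltn_neqAle eq_sym nkj.
  by rewrite [in LHS](_ : val k = (j + (1 + (k - j.+1)))%N) ?exprD ?expr1 -?mulrA //
    add1n -subSn // subSS subnKC.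
have nC0 k : ~ C 0%N (a 0%N ^+ k).
  elim: k => [|k IHk]; first by have [] := Cprime 0%N isT.
  by rewrite exprS => /CM0[].
(* No power of [a 0] lies in the prime [C 0], so the other factor does. As [C 1] contains both [C 0]
   and [a 0], it contains [b j]. *)
move: sumC; rewrite sumE => /CM0[/nC0//|/C01].
by apply: idealDr => //; apply: ideal_mulr.
Qed.

End PowerProducts.

Section Dimension.
Variables (K : fieldType) (n : nat).
Local Notation S := {mpoly K[n]}.
Implicit Types (p q : S).

Definition deg_le d p := forall m, m \in msupp p -> (mdeg m <= d)%N.

Lemma deg_le1 : deg_le 0 1.
Proof. by move=> m; rewrite msupp1 inE => /eqP ->; rewrite mdeg0. Qed.

Lemma deg_leM d e p q : deg_le d p -> deg_le e q -> deg_le (d + e) (p * q).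
Proof.
move=> dp dq m /msuppM_le/allpairsP[[m1 m2] /= [/dp l1 /dq l2 ->]].
by rewrite mdegD leq_add.
Qed.

Lemma deg_leX d p k : deg_le d p -> deg_le (k * d) (p ^+ k).
Proof.
move=> dp; elim: k => [|k IH]; first exact: deg_le1.
by rewrite exprS mulSn; apply: deg_leM.
Qed.

Lemma deg_leW d e p : (d <= e)%N -> deg_le d p -> deg_le e p.
Proof. by move=> lede dp m /dp/leq_trans; apply. Qed.

Lemma deg_le_power_product N D (a : nat -> S) h (e : exponents N h) :
  (forall i, (i < h)%N -> deg_le D (a i)) -> deg_le (h * (N * D)) (power_product a e).
Proof.
elim: h a e => [|h IH] a e da /=; first exact: deg_le1.
rewrite mulSn; apply: deg_leM; last by apply: IH => i lti; apply: da.
apply: (@deg_leW (e.1 * D)); last exact/deg_leX/da.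
by rewrite leq_mul2r ltnW ?orbT.
Qed.

Lemma deg_le_exists h (a : nat -> S) : exists D, forall i, (i < h)%N -> deg_le D (a i).
Proof.
exists (\max_(i < h) msize (a i)) => i lti m /msize_mdeg_lt/ltnW/leq_trans; apply.
exact: (leq_bigmax (F := fun j : 'I_h => msize (a j)) (Ordinal lti)).
Qed.

Lemma mpolyX_ideal (I : S -> Prop) (m : 'X_{1..n}) i :
  ideal I -> I 'X_i -> m i != 0%N -> I 'X_[m].
Proof.
move=> hI Ii mi; have le1 : (U_(i) <= m)%MM.
  by apply/mnm_lepP => j; rewrite mnm1E; case: eqP => [<-|//]; rewrite lt0n.
by rewrite -(submK le1) mpolyXD; apply: ideal_mull.
Qed.

(* There are N ^ h power products of the a i against (h N D + 1) ^ #|V|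
   monomials in the variables outside C 0 that could occur in them. *)
Lemma relation_exists (C0 : S -> Prop) (a : nat -> S) :
  ideal C0 ->
  exists N, exists2 c : exponents N #|[set i | asbool (~ C0 'X_i)]|.+1 -> K,
    (exists e, c e != 0) & C0 (\sum_e (c e)%:MP * power_product a e).
Proof.
move=> hC; set V := [set i | _]; set h := #|V|.+1.
have [D degD] := deg_le_exists h a.
(* [N] exceeds [(h * D).+1 ^ #|V|] and [B <= N * (h * D).+1]; as [h] is [#|V|.+1], it follows that
   [B ^ #|V| < N ^ h]. *)
pose N := ((h * D).+1 ^ #|V|).+1; pose B := (h * (N * D)).+1.
pose mon (f : {ffun {i | i \in V} -> 'I_B}) : 'X_{1..n} :=
  [multinom (if insub i is Some x then f x : nat else 0%N) | i < n].
have ltcard : (#|{ffun {i | i \in V} -> 'I_B}| < #|exponents N h|)%N.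
  rewrite card_ffun card_exponents card_ord card_sig /h expnS.
  have leB : (B <= N * (h * D).+1)%N.
    by rewrite /B mulnCA [(N * _.+1)%N]mulnS -add1n leq_add2r.
  apply: (@leq_ltn_trans ((N * (h * D).+1) ^ #|V|)).
    by have [->//|V0] := posnP #|V|; rewrite leq_exp2r.
  by rewrite expnMn mulnC ltn_pmul2r ?expn_gt0 // ltnSn.
pose M := \matrix_(i < #|exponents N h|, j < #|{ffun {i | i \in V} -> 'I_B}|)
  (power_product a (enum_val i))@_(mon (enum_val j)).
(* [M] has more rows than columns, so some nonzero combination of the power products has no monomial
   in the variables of [V] alone. *)
have [v /sub_kermxP vM v0] : exists2 v : 'rV_#|exponents N h|, (v <= kermx M)%MS & v != 0.
  apply/rowV0Pn; rewrite kermx_eq0.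
  by rewrite /row_free neq_ltn (leq_ltn_trans (rank_leq_col M)) ?ltcard.
exists N, (fun e => v 0 (enum_rank e)).
  have /rV0Pn[i vi] := v0; exists (enum_val i); by rewrite enum_valK.
set q := \sum_e _; have dq : deg_le (h * (N * D)) q.
  move=> m; rewrite mcoeff_msupp /q raddf_sum /=; apply: contraR => lem.
  rewrite big1 // => e _; rewrite mcoeffCM; apply/eqP; rewrite mulf_eq0; apply/orP; right.
  by rewrite mcoeff_eq0; apply: contra lem; exact: (deg_le_power_product degD).
have qmon f : q@_(mon f) = 0.
  have /rowP/(_ (enum_rank f)) := vM; rewrite !mxE => <-.
  rewrite /q raddf_sum /= (reindex (fun i : 'I_#|exponents N h| => enum_val i)) /=; last first.
    by apply: onW_bij; apply: enum_val_bij.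
  by apply: eq_bigr => i _; rewrite mcoeffCM !mxE enum_valK enum_rankK.
rewrite (mpolyE q); apply: ideal_sum => // m _.
(* A monomial with a variable outside [V] lies in [C0]. Any other monomial of [q] has exponents
   below [B], so it is of the form [mon f] and its coefficient vanishes. *)
have [mV|/forallPn[i]] := boolP [forall i, (i \notin V) ==> (m i == 0%N)]; last first.
  rewrite negb_imply => /andP[]; rewrite inE => /asboolPn/contrapT Ci mi.
  by rewrite -mul_mpolyC; apply: ideal_mull => //; apply: mpolyX_ideal mi.
have [mB|nB] := boolP (m \in msupp q); last first.
  by rewrite (memN_msupp_eq0 nB) scale0r; apply: ideal0.
have ltB i : (m i < B)%N.
  by rewrite ltnS (leq_trans _ (dq _ mB)) // mdegE (bigD1 i) //= leq_addr.
suff -> : m = mon [ffun x => Ordinal (ltB (sval x))].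
  by rewrite qmon scale0r; apply: ideal0.
apply/mnmP => i; rewrite mnmE; case: insubP => [x _ xi|niV]; first by rewrite ffunE /= xi.
by have /forallP/(_ i) := mV; rewrite niV => /eqP.
Qed.

(** In a longer chain, elements [a i] of [C i.+1] outside [C i] would satisfy a relation by
    counting, against [power_product_free]. *)
Theorem prime_chain_length P h C : @prime_chain_to S P h C ->
  (h <= #|[set i | asbool (~ C 0%N 'X_i)]|)%N.
Proof.
move=> [Cprime Cstrict _]; set V := [set i | _]; rewrite leqNgt; apply/negP => ltVh.
have /choice[a aP] i : exists a, (i < h)%N -> C i.+1 a /\ ~ C i a.
  have [lti|] := ltnP i h; last by exists 0.
  have [_ nsub] := Cstrict i lti; apply: contrapT => na; apply: nsub => y Cy.
  by apply: contrapT => nCy; apply: na; exists y.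
have hC0 : ideal (C 0%N) by have [] := Cprime 0%N isT.
have [N [c [e ce0] sumC]] := relation_exists a hC0.
suff c0 : c e = 0 by rewrite c0 eqxx in ce0.
apply: (power_product_free (g := @mpolyC n K) (C := C) _ _ sumC).
- by move=> i lei; apply: Cprime; apply: leq_trans ltVh.
move=> i lti; have lti' := leq_trans lti ltVh; have [sub _] := Cstrict i lti'.
by have [Ca nCa] := aP i lti'.
Qed.

End Dimension.

(** * Elementary symmetric parameters *)

Section UnivariateIdeals.
Variables (K : fieldType) (T : finType).
Local Notation S := {mpoly K[#|T|]}.
Implicit Types (p q : S) (v x : T).

Local Notation X v := ('X_(enum_rank v) : S).

Definition eval_at v (w : {poly K}) : S := (map_poly (@mpolyC _ K) w).[X v].

Section Univariate.
Variable v : T.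

(* S as a polynomial ring in X v over the other variables, embedded in S[Y]. *)
Definition expand_map : {rmorphism S -> {poly S}} :=
  mmap (polyC \o @mpolyC #|T| K)
       (fun i => if i == enum_rank v then 'X else ('X_i)%:P).

Lemma expand_mapC c : expand_map c%:MP = (c%:MP)%:P.
Proof. exact: mmapC. Qed.

Lemma expand_mapX x : expand_map (X x) = if x == v then 'X else (X x)%:P.
Proof. by rewrite /expand_map /= mmapX mmap1U (inj_eq enum_rank_inj). Qed.

Lemma expand_mapK p : (expand_map p).[X v] = p.
Proof.
rewrite {2}(mpolyE p) /= /mmap horner_sum; apply: eq_bigr => m _.
rewrite /= hornerCM mul_mpolyC; congr (_ *: _).
rewrite /mmap1 horner_prod [RHS]mpolyXE_id; apply: eq_bigr => i _.
by rewrite horner_exp; case: eqP => [->|_]; rewrite ?hornerX ?hornerC.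
Qed.

Lemma expand_map_eval_at x w :
  expand_map (eval_at x w) =
    if x == v then map_poly (@mpolyC _ K) w else (eval_at x w)%:P.
Proof.
rewrite /eval_at -horner_map -map_poly_comp expand_mapX.
have -> : map_poly (expand_map \o @mpolyC _ K) w =
          map_poly polyC (map_poly (@mpolyC _ K) w).
  by rewrite -map_poly_comp; apply: eq_map_poly => c; apply: expand_mapC.
case: eqP => _; last by rewrite horner_map.
exact: comp_polyXr.
Qed.

End Univariate.

(** As [q] is monic, the leading coefficient of [p] is also that of [p * q], so it lies in [J]; the
    leading term is subtracted and the degree drops. *)
Lemma monic_regular (R : comNzRingType) (J : R -> Prop) (q p : {poly R}) :
  ideal J -> q \is monic ->
  (forall k, J (p * q)`_k) -> forall k, J p`_k.
Proof.
move=> hJ mon_q; have [m] := ubnP (size p); elim: m p => // m IH p.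
rewrite ltnS => sp Jpq.
have [->|p0] := eqVneq p 0; first by move=> k; rewrite coef0; apply: ideal0.
have q0 := monic_neq0 mon_q.
have Jl : J (lead_coef p).
  by rewrite -(lead_coef_Mmonic p mon_q) lead_coefE; apply: Jpq.
pose t := (lead_coef p)%:P * 'X^((size p).-1).
have Jt k : J t`_k.
  by rewrite coefCM; apply: ideal_mulr.
move=> k; rewrite -(subrK t p) coefD; apply: idealD => //.
apply: IH => [|{}k].
  apply: leq_trans sp; rewrite -size_poly_gt0 in p0.
  rewrite -(prednK p0) ltnS; apply/leq_sizeP => j.
  rewrite leq_eqVlt coefB coefCM coefXn => /orP[/eqP<-|ltj].
    by rewrite eqxx mulr1 subrr.
  rewrite gtn_eqF // mulr0 subr0 nth_default // -(prednK p0) //.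
rewrite mulrBl coefB; apply: idealB => //.
rewrite coefM; apply: ideal_sum => // i _; exact: ideal_mulr.
Qed.

Variable w : T -> {poly K}.

Definition univariate_ideal (U : {set T}) p :=
  exists c : T -> S, p = \sum_(v in U) c v * eval_at v (w v).

Lemma ideal_univariate U : ideal (univariate_ideal U).
Proof.
split.
- by exists (fun=> 0); rewrite big1 // => v _; rewrite mul0r.
- move=> _ _ [c ->] [d ->]; exists (fun v => c v + d v).
  by rewrite -big_split; apply: eq_bigr => v _; rewrite mulrDl.
- move=> a _ [c ->]; exists (fun v => a * c v).
  by rewrite mulr_sumr; apply: eq_bigr => v _; rewrite mulrA.
Qed.

Lemma mem_univariate_ideal (U : {set T}) v :
  v \in U -> univariate_ideal U (eval_at v (w v)).
Proof.
move=> vU; exists (fun x => (x == v)%:R); rewrite (bigD1 v) //= eqxx mul1r.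
by rewrite big1 ?addr0 // => x /andP[_ /negbTE ->]; rewrite mul0r.
Qed.

Lemma univariate_ideal_min (U : {set T}) I : ideal I ->
  (forall v, v \in U -> I (eval_at v (w v))) -> subideal (univariate_ideal U) I.
Proof.
move=> hI UI _ [c ->]; apply: ideal_sum => // v vU.
by apply: ideal_mull => //; apply: UI.
Qed.

Lemma univariate_idealU1 (U : {set T}) v :
  univariate_ideal (v |: U) = add_principal (univariate_ideal U) (eval_at v (w v)).
Proof.
have hU := ideal_univariate U; apply: eq_ideal.
  apply: univariate_ideal_min => [|x]; first exact: ideal_add_principal.
  rewrite in_setU1 => /orP[/eqP->|xU]; first exact: mem_add_principal.
  by apply: sub_add_principal; apply: mem_univariate_ideal.
apply: add_principal_min; first exact: ideal_univariate.
  apply: univariate_ideal_min => [|x xU]; first exact: ideal_univariate.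
  by apply: mem_univariate_ideal; rewrite in_setU1 xU orbT.
by apply: mem_univariate_ideal; rewrite setU11.
Qed.

Hypothesis w_monic : forall v, w v \is monic.

(** The generators do not involve the variable of [v], so membership is decided on the coefficients
    with respect to that variable. *)
Lemma univariate_ideal_coef (U : {set T}) v p : v \notin U ->
  univariate_ideal U p <-> forall k, univariate_ideal U (expand_map v p)`_k.
Proof.
have hU := ideal_univariate U; move=> vU; split.
  move=> [c ->] k; rewrite rmorph_sum coef_sum; apply: ideal_sum => // x xU.
  rewrite rmorphM expand_map_eval_at ifN; last by apply: contraNneq vU => <-.
  by rewrite coefMC; apply: ideal_mull => //; apply: mem_univariate_ideal.
move=> coefU; rewrite -(expand_mapK v p) horner_coef.
by apply: ideal_sum => // k _; apply: ideal_mulr.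
Qed.

Lemma univariate_ideal_regular (U : {set T}) v p : v \notin U ->
  univariate_ideal U (p * eval_at v (w v)) -> univariate_ideal U p.
Proof.
move=> vU /(univariate_ideal_coef _ vU) pw; apply/(univariate_ideal_coef _ vU).
apply: (monic_regular (ideal_univariate U) (monic_map (@mpolyC #|T| K) (w_monic v))).
by move=> k; have := pw k; rewrite rmorphM expand_map_eval_at eqxx.
Qed.

End UnivariateIdeals.

Lemma weakly_regular_cons_mod (R : comNzRingType) (I : R -> Prop) x y xs :
  ideal I -> I (x - y) -> weakly_regular I (y :: xs) -> weakly_regular I (x :: xs).
Proof.
move=> hI Ixy /= [reg wxs]; split.
  move=> a Iax; apply: reg; have -> : a * y = a * x - a * (x - y) by ring.
  by apply: idealB => //; apply: ideal_mull.
suff -> : add_principal I x = add_principal I y by [].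
apply: eq_ideal; apply: add_principal_min;
  do ?[exact: ideal_add_principal | exact: sub_add_principal].
  exists (x - y), 1; split=> //; ring.
by exists (- (x - y)), 1; split; [apply: idealN|ring].
Qed.

Section Elementary.
Variables (R : comNzRingType) (T : finType) (y : T -> R).

Definition elem_sym k : R := \sum_(A : {set T} | #|A| == k) \prod_(v in A) y v.

(** In descending order: for a simplex of size [k] the first entry reduces to a single product. *)
Fixpoint elem_syms k : seq R := if k is k'.+1 then elem_sym k :: elem_syms k' else [::].

Lemma size_elem_syms k : size (elem_syms k) = k.
Proof. by elim: k => //= k ->. Qed.

Lemma mem_elem_syms (I : R -> Prop) k :
  ideal I -> (forall v, I (y v)) -> forall x, x \in elem_syms k -> I x.
Proof.
move=> hI Iy; elim: k => // k IH x; rewrite inE => /orP[/eqP ->|]; last exact: IH.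
apply: ideal_sum => // A /eqP cA.
have /set0Pn[v vA] : A != set0 by rewrite -cards_eq0 cA.
by rewrite (bigD1 v) //=; apply: ideal_mulr.
Qed.

(** Any other set of the same size has a point outside [C], so its product lies in [I]. *)
Lemma elem_sym_mod (I : R -> Prop) (C : {set T}) : ideal I ->
  (forall v, v \notin C -> I (y v)) -> I (elem_sym #|C| - \prod_(v in C) y v).
Proof.
move=> hI Iy; rewrite /elem_sym (bigD1 C) //= [X in X - _]addrC addrK.
apply: ideal_sum => // A /andP[/eqP cA nAC].
have /subsetPn[v vA vC] : ~~ (A \subset C).
  by apply: contraNN nAC => sAC; rewrite eqEcard sAC cA leqnn.
by rewrite (bigD1 v) //=; apply: ideal_mulr => //; apply: Iy.
Qed.

End Elementary.

Section FaceRegular.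
Variables (K : fieldType) (T : finType).
Local Notation S := {mpoly K[#|T|]}.
Local Notation X v := ('X_(enum_rank v) : S).
Variable h : T -> {poly K}.
Hypothesis h_monic : forall v, h v \is monic.

Definition parameter v : S := X v * eval_at v (h v).

(** On a simplex the top symmetric function is the product of the parameters, each of them regular.
    Modulo this product it is enough to kill one factor at a time, which leaves the same situation
    with one point fewer. *)
Lemma weakly_regular_face (F : {set T}) :
  weakly_regular (univariate_ideal (fun=> 'X : {poly K}) (~: F)) (elem_syms parameter #|F|).
Proof.
(* Outside [F] the variable itself is killed; inside [F] it is the parameter, given by the
   polynomial ['X * h v]. *)
pose w v := if v \in F then 'X * h v else 'X.
have w_monic v : w v \is monic by rewrite /w; case: ifP => _; rewrite ?monicMl ?monicX.
have evalX v : eval_at v ('X : {poly K}) = X v by rewrite /eval_at map_polyX hornerX.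
have wE v : v \in F -> eval_at v (w v) = parameter v.
  by move=> vF; rewrite /w vF /eval_at rmorphM hornerM /= map_polyX hornerX.
have -> : univariate_ideal (fun=> 'X : {poly K}) (~: F) = univariate_ideal w (~: F).
  apply/funext => p; rewrite /univariate_ideal; congr ex; apply/funext => c.
  congr (p = _); apply: eq_bigr => v; rewrite inE => /negbTE vF.
  by rewrite /w vF.
(* [C] consists of the points of [F] whose parameters have not been killed yet. *)
suff main (C : {set T}) : C \subset F ->
    weakly_regular (univariate_ideal w (~: C)) (elem_syms parameter #|C|) by exact: main.
have [k] := ubnP #|C|; elim: k C => // k IH C; rewrite ltnS => sC CF.
have hC := ideal_univariate w (~: C).
case cC: #|C| => [//|m].
have regC v y : v \in C -> univariate_ideal w (~: C) (y * parameter v) ->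
    univariate_ideal w (~: C) y.
  move=> vC; rewrite -wE ?(subsetP CF) //; apply: univariate_ideal_regular => //.
  by rewrite inE negbK.
apply: (@weakly_regular_cons_mod _ _ _ (\prod_(v in C) parameter v)) => //.
  rewrite -cC; apply: elem_sym_mod => // v vC.
  have [vF|vF] := boolP (v \in F).
    by rewrite -wE //; apply: mem_univariate_ideal; rewrite inE.
  apply: ideal_mulr => //; rewrite -evalX.
  have -> : 'X = w v by rewrite /w (negbTE vF).
  by apply: mem_univariate_ideal; rewrite inE.
split; first by move=> a; apply: regular_prod => v y; apply: regC.
apply: weakly_regular_prod => // v vC; rewrite -wE ?(subsetP CF) //.
rewrite -univariate_idealU1.
have -> : v |: ~: C = ~: (C :\ v) by rewrite setDE setCI setCK setUC.
have cCv : #|C :\ v| = m by apply/eqP; rewrite -eqSS -cC (cardsD1 v C) vC.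
rewrite -cCv; apply: IH; first by rewrite cCv -ltnS -cC.
exact: subset_trans (subsetDl _ _) CF.
Qed.

End FaceRegular.

(** * Vertex decomposable complexes *)

Section MonomialIdeals.
Variables (K : fieldType) (T : finType).
Local Notation S := {mpoly K[#|T|]}.
Local Notation X x := ('X_(enum_rank x) : S).
Implicit Types (D : {set {set T}}) (F G : {set T}) (m : 'X_{1..#|T|}) (p q : S).

Definition down_closed D := forall F G, F \in D -> G \subset F -> G \in D.

Definition mon_support m : {set T} := [set x | m (enum_rank x) != 0%N].

(** The Stanley-Reisner ideal of a complex, described by coefficients, so that ideal operations with
    a variable become operations on supports. *)
Definition nonface_ideal D p := forall m, mon_support m \in D -> p@_m = 0.

(** The closed star of a vertex [x], a cone over its link. It is the complex of the colon ideal,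
    since multiplying by the variable adds [x] to supports. *)
Definition star D x : {set {set T}} := [set G | x |: G \in D].

Lemma supportD m1 m2 : mon_support (m1 + m2)%MM = mon_support m1 :|: mon_support m2.
Proof. by apply/setP => x; rewrite !inE mnmDE addn_eq0 negb_and. Qed.

Lemma supportU x : mon_support U_(enum_rank x)%MM = [set x].
Proof.
apply/setP => y; rewrite !inE mnm1E (inj_eq enum_rank_inj) [x == y]eq_sym.
by case: (y == x).
Qed.

Lemma ideal_nonface D : down_closed D -> ideal (nonface_ideal D).
Proof.
move=> downD; split=> [m _|p q Ip Iq m mD|a p Ip m mD]; first by rewrite mcoeff0.
  by rewrite mcoeffD Ip ?Iq ?addr0.
apply/eqP; rewrite mcoeff_eq0; apply/negP => /msuppM_le/allpairsP[[m1 m2] /= [_ m2p mE]].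
move: m2p; rewrite mcoeff_msupp Ip ?eqxx //.
by apply: downD mD _; rewrite mE supportD subsetUr.
Qed.

Lemma nonface_ideal_min D (I : S -> Prop) : ideal I ->
  (forall m, mon_support m \notin D -> I 'X_[m]) -> subideal (nonface_ideal D) I.
Proof.
move=> hI DI p Ip; rewrite (mpolyE p); apply: ideal_sum => // m _.
have [mD|/DI] := boolP (mon_support m \in D); first by rewrite Ip // scale0r; apply: ideal0.
by rewrite -mul_mpolyC; apply: ideal_mull.
Qed.

Lemma nonface_idealX D m : nonface_ideal D 'X_[m] <-> mon_support m \notin D.
Proof.
split=> [Im|mD k kD].
  by apply/negP => /Im; rewrite mcoeffX eqxx => /eqP; rewrite oner_eq0.
by rewrite mcoeffX; case: eqP => // mk; rewrite mk kD in mD.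
Qed.

Lemma colon_nonface D x : colon (nonface_ideal D) (X x) = nonface_ideal (star D x).
Proof.
apply: eq_ideal => p Ip m.
  by rewrite inE -supportU -supportD => /Ip; rewrite mcoeffMX.
move=> mD; apply/eqP; rewrite mcoeff_eq0; apply/negP.
move=> /msuppM_le/allpairsP[[k u] /= [kp]]; rewrite msuppX inE => /eqP -> mE.
move: kp; rewrite mcoeff_msupp Ip ?eqxx // inE.
by rewrite setUC -supportU -supportD -mE.
Qed.

Lemma down_closed_deletion D F : down_closed D -> down_closed (deletion D F).
Proof.
move=> downD G H; rewrite !inE => /andP[GD GF] HG; rewrite (downD _ _ GD HG) /=.
by rewrite -subset0 -(eqP GF) setSI.
Qed.

Lemma add_principal_nonface D x : down_closed D ->
  add_principal (nonface_ideal D) (X x) = nonface_ideal (deletion D [set x]).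
Proof.
move=> downD; have hI := ideal_nonface (down_closed_deletion (F := [set x]) downD).
have hD := ideal_nonface downD.
apply: eq_ideal.
  apply: add_principal_min => // [p Ip m|].
    by rewrite inE => /andP[/Ip].
  by apply/nonface_idealX; rewrite supportU inE setIid -cards_eq0 cards1 andbF.
apply: nonface_ideal_min => [|m mD]; first exact: ideal_add_principal.
have [mD'|mD'] := boolP (mon_support m \in D); last first.
  by apply: sub_add_principal; apply/nonface_idealX.
apply: (mpolyX_ideal (i := enum_rank x)).
- exact: ideal_add_principal.
- exact: mem_add_principal.
- move: mD; rewrite inE mD' /= setIC => /set0Pn[y].
  by rewrite !inE => /andP[/eqP->].
Qed.

Lemma nonface_ideal_powerset F :
  nonface_ideal (powerset F) = univariate_ideal (fun=> 'X : {poly K}) (~: F).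
Proof.
have evalX v : eval_at v ('X : {poly K}) = X v by rewrite /eval_at map_polyX hornerX.
apply: eq_ideal.
  apply: nonface_ideal_min => [|m]; first exact: ideal_univariate.
  rewrite powersetE => /subsetPn[v vm vF].
  apply: (mpolyX_ideal (i := enum_rank v)); first exact: ideal_univariate.
    rewrite -evalX.
    by apply: (mem_univariate_ideal (fun=> 'X)); rewrite inE.
  by rewrite inE in vm.
apply: univariate_ideal_min.
  apply: ideal_nonface => A B; rewrite !powersetE => AF BA; exact: subset_trans AF.
move=> v vF; rewrite evalX; apply/nonface_idealX.
by rewrite supportU powersetE sub1set; rewrite inE in vF.
Qed.

Lemma weakly_regular_star_deletion D x s : down_closed D ->
  weakly_regular (nonface_ideal (star D x)) s ->
  weakly_regular (nonface_ideal (deletion D [set x])) s ->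
  weakly_regular (nonface_ideal D) s.
Proof.
move=> downD wstar wdel; apply: (@weakly_regular_colon _ _ (X x)).
- exact: ideal_nonface.
- by rewrite colon_nonface.
- by rewrite add_principal_nonface.
Qed.

End MonomialIdeals.

Section FacesOfDeletionAndLink.
Variable T : finType.
Implicit Types (D : {set {set T}}) (F G : {set T}).

Lemma facetP D F : reflect (F \in D /\ forall G, G \in D -> F \subset G -> G = F)
  (F \in facets D).
Proof. by rewrite inE; apply: maxsetP. Qed.

Lemma facet_exists D F : F \in D -> exists2 G, G \in facets D & F \subset G.
Proof. by case/maxset_exists => G maxG FG; exists G; rewrite ?inE. Qed.

Lemma in_link1 D x G : (G \in link D [set x]) = [&& G \in D, x \notin G & x |: G \in D].
Proof. by rewrite inE setI_eq0 disjoint_sym disjoints1 setUC. Qed.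

Lemma in_deletion1 D x G : (G \in deletion D [set x]) = (G \in D) && (x \notin G).
Proof. by rewrite inE setI_eq0 disjoint_sym disjoints1. Qed.

Lemma down_closed_link1 D x : down_closed D -> down_closed (link D [set x]).
Proof.
move=> downD G H; rewrite !in_link1 => /and3P[GD xG xGD] HG.
rewrite (downD _ _ GD HG) (downD _ _ xGD (setUS _ HG)) andbT /=.
by apply: contraNN xG; apply: (subsetP HG).
Qed.

(** Passes purity from [D] to the link, with facets smaller by one. *)
Lemma facets_link1 D x G : down_closed D ->
  G \in facets (link D [set x]) -> x |: G \in facets D /\ x \notin G.
Proof.
move=> downD /facetP[]; rewrite in_link1 => /and3P[GD xG xGD] maxG.
split=> //; apply/facetP; split=> // H HD xGH.
have xH : x \in H by rewrite (subsetP xGH) ?setU11.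
rewrite -(maxG (H :\ x)) ?setD1K //.
  by rewrite in_link1 setD11 setD1K // HD /= andbT; apply: downD HD (subD1set _ _).
by rewrite subsetD1 xG andbT (subset_trans _ xGH) // subsetUr.
Qed.

Lemma facets_powerset F : facets (powerset F) = [set F].
Proof.
apply/setP => G; rewrite [RHS]inE; apply/facetP/eqP => [[]|->].
  by rewrite powersetE => GF maxG; rewrite (maxG F) ?powersetE.
by rewrite powersetE; split=> // H; rewrite powersetE => HF FH; apply/eqP; rewrite eqEsubset HF.
Qed.

End FacesOfDeletionAndLink.

Section PartialExpansions.
Variables (T T' : finType) (pi : T' -> T).
Implicit Types (D : {set {set T}}) (W C G : {set T'}) (a : T) (y : T').

(* The join of the simplex on C with the complex obtained from D by replacing
   each point a by its copies in W, the y with pi y = a. *)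
Definition partial_expansion D W C : {set {set T'}} :=
  [set G : {set T'} | [&& G :\: C \subset W, #|pi @: (G :\: C)| == #|G :\: C|
     & pi @: (G :\: C) \in D]].

Lemma down_closed_partial_expansion D W C :
  down_closed D -> down_closed (partial_expansion D W C).
Proof.
move=> downD G H; rewrite !inE => /and3P[GW /imset_injP injG GD] HG.
have HG' : H :\: C \subset G :\: C by apply: setSD.
rewrite (subset_trans HG' GW) (downD _ _ GD (imsetS _ HG')) andbT /=.
by apply/imset_injP; apply: sub_in2 injG; apply/subsetP.
Qed.

(** A face containing the copy [y] has no other copy of [pi y]. So [y] becomes a cone point, and the
    remaining copies see only the link of [pi y]; those of [pi y] itself become inert. *)
Lemma star_partial_expansion D W C y : down_closed D -> [disjoint C & W] -> y \in W ->
  star (partial_expansion D W C) y =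
  partial_expansion (link D [set pi y]) (W :\ y) (y |: C).
Proof.
move=> downD dCW yW; have yC : y \notin C by rewrite (disjointFl dCW).
apply/setP => G; rewrite !inE.
pose H := G :\: (y |: C); have -> : (y |: G) :\: C = y |: H.
  by apply/setP => z; rewrite !inE; case: eqP => [->|]; rewrite ?yC.
rewrite -/H; have yH : y \notin H by rewrite !inE eqxx.
rewrite subUset sub1set yW /= imsetU1 !cardsU1 yH add1n subsetD1 yH andbT.
rewrite [pi @: H :|: _]setUC setI_eq0 disjoint_sym disjoints1.
have [piyH|piyH] /= := boolP (pi y \in pi @: H).
  (* Here [y |: H] would contain two copies of [pi y]: its image is too small, and both sides
     fail. *)
  by rewrite !andbF ltn_eqF ?andbF // add0n ltnS leq_imset_card.
rewrite add1n eqSS; congr [&& _, _ & _]; apply/idP/andP => [yHD|[] //].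
by split=> //; apply: downD yHD (subsetUr _ _).
Qed.

Lemma deletion_partial_expansion D W C y : y \notin C ->
  deletion (partial_expansion D W C) [set y] = partial_expansion D (W :\ y) C.
Proof.
move=> yC; apply/setP => G; rewrite !inE subsetD1 setI_eq0 disjoint_sym disjoints1.
by rewrite in_setD yC /= -!andbA; congr (_ && _); rewrite [in RHS]andbC andbA.
Qed.

Lemma partial_expansion_deletion D W C a : (forall y, y \in W -> pi y != a) ->
  partial_expansion D W C = partial_expansion (deletion D [set a]) W C.
Proof.
move=> Wa; apply/setP => G; rewrite !inE; have [GW /=|//] := boolP (G :\: C \subset W).
congr (_ && _); rewrite setI_eq0 disjoint_sym disjoints1.
suff -> : a \notin pi @: (G :\: C) by rewrite andbT.
by apply/imsetP => -[y /(subsetP GW)/Wa/eqP nya /esym].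
Qed.

Lemma partial_expansion_simplex (A : {set T}) W C :
  {in W :&: pi @^-1: A &, injective pi} ->
  partial_expansion (powerset A) W C = powerset (C :|: W :&: pi @^-1: A).
Proof.
move=> injW; apply/setP => G; rewrite !inE -subDset subsetI -sub_imset_pre.
have [GW /=|//] := boolP (G :\: C \subset W).
have [GA|//] := boolP (pi @: (G :\: C) \subset A); rewrite ?andbF // andbT.
apply/imset_injP; apply: sub_in2 injW => y yG.
by rewrite !inE (subsetP GW) // (subsetP GA) // imset_f.
Qed.

End PartialExpansions.

Section VertexDecomposableRegular.
Variables (K : fieldType) (T T' : finType) (pi : T' -> T).
Variables (h : T' -> {poly K}) (d : nat).
Hypothesis h_monic : forall v, h v \is monic.
Implicit Types (D : {set {set T}}) (W C : {set T'}).

Local Notation regular D W C :=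
  (weakly_regular (@nonface_ideal K T' (partial_expansion pi D W C))
     (elem_syms (parameter h) d)).

Lemma regular_step D W C y : down_closed D -> [disjoint C & W] -> y \in W ->
  regular (link D [set pi y]) (W :\ y) (y |: C) -> regular D (W :\ y) C -> regular D W C.
Proof.
move=> downD dCW yW wlink wdel; apply: (@weakly_regular_star_deletion _ _ _ y).
- exact: down_closed_partial_expansion.
- by rewrite star_partial_expansion.
- by rewrite deletion_partial_expansion // (disjointFl dCW).
Qed.

Lemma disjointU1D W C y : [disjoint C & W] -> [disjoint y |: C & W :\ y].
Proof.
move=> dCW; rewrite -setI_eq0 setIUl setU_eq0 !setI_eq0 disjoints1 setD11 /=.
by apply: disjointWr dCW; apply: subD1set.
Qed.

(** The expansion of a simplex is in general not a simplex. If [y] and [z] are copies of the same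
    point, the star of [y] trades this point for a cone point, and the deletion of [y] still has the
    copy [z]; both have fewer copies. With single copies the complex is a simplex. *)
Lemma regular_simplex (A : {set T}) W C :
  (forall a, a \in A -> exists2 y, y \in W & pi y = a) ->
  [disjoint C & W] -> (#|C| + #|A| = d)%N -> regular (powerset A) W C.
Proof.
have [m] := ubnP #|W|; elim: m A W C => // m IH A W C; rewrite ltnS => sW copyA dCW dE.
have downA (B : {set T}) : down_closed (powerset B).
  by move=> F G; rewrite !powersetE => FB GF; apply: subset_trans FB.
have [injW|] := boolP (dinjectiveb pi (W :&: pi @^-1: A)).
  move/dinjectiveP: injW => injW; rewrite partial_expansion_simplex //.
  rewrite nonface_ideal_powerset -dE.
  have -> : (#|C| + #|A| = #|C :|: W :&: pi @^-1: A|)%N.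
    rewrite cardsU (disjoint_setI0 (disjointWr (subsetIl _ _) dCW)) cards0 subn0.
    congr (_ + _)%N; rewrite -(card_in_imset injW); congr #|pred_of_set _|.
    apply/setP => a; apply/idP/imsetP => [aA|[y]].
      by have [y yW ya] := copyA a aA; exists y; rewrite ?inE ?yW ?ya.
    by rewrite !inE => /andP[_ yA] ->.
  exact: weakly_regular_face.
case/dinjectivePn => y; rewrite !inE => /andP[yW yA] [z].
rewrite !inE => /andP[zy /andP[zW zA]] yz.
have sWy : (#|W :\ y| < m)%N by apply: leq_trans sW; rewrite [in X in (_ < X)%N](cardsD1 y) yW.
have copyW a : a \in A -> exists2 x, x \in W :\ y & pi x = a.
  move=> aA; have [x xW xa] := copyA a aA.
  have [xy|xy] := eqVneq x y; last by exists x; rewrite ?inE ?xy.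
  by exists z; rewrite ?inE ?zy //= -yz -xy.
apply: (@regular_step _ _ _ y) => //.
  have -> : link (powerset A) [set pi y] = powerset (A :\ pi y).
    apply/setP => G; rewrite in_link1 !powersetE subsetD1 subUset sub1set yA.
    by case: (G \subset A); rewrite ?andbT.
  apply: IH => //.
  - by move=> a; rewrite inE => /andP[_ aA]; apply: copyW.
  - exact: disjointU1D.
  - rewrite cardsU1 (disjointFl dCW) // -dE (cardsD1 (pi y) A) yA; lia.
by apply: IH => //; apply: disjointWr dCW; apply: subD1set.
Qed.

(** Induction on the decomposition, and for a shedding vertex on the number of its copies. The
    invariant [#|C| + k = d] keeps the sequence unchanged: in a star the facets lose a point and [C]
    gains one. *)
Theorem regular_vertex_decomposable D W C k : vertex_decomposable D -> down_closed D ->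
  (forall F, F \in facets D -> #|F| = k) ->
  (forall a, a \in vertices D -> exists2 y, y \in W & pi y = a) ->
  [disjoint C & W] -> (#|C| + k = d)%N -> regular D W C.
Proof.
move=> vdD; elim: vdD W C k => {D} [A|D x xD vdel IHdel vlink IHlink sub] W C k downD pureD copyD dCW dE.
  apply: regular_simplex => // [a aA|].
    by apply: copyD; rewrite inE powersetE sub1set.
  by rewrite (pureD A) // facets_powerset inE.
(* Some facet contains the vertex [x], so the common facet size is positive. *)
have [k' kE] : exists k', k = k'.+1.
  have [F FD xF] := facet_exists (D := D) (F := [set x]) ltac:(by rewrite inE in xD).
  exists k.-1; rewrite prednK // -(pureD F FD).
  by rewrite card_gt0; apply/set0Pn; exists x; rewrite -sub1set.
have linkC W0 C0 y : pi y = x -> [disjoint C0 & W0] -> y \in W0 -> #|C0| = #|C| ->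
    (forall a, a \in vertices D -> a != x -> exists2 z, z \in W0 & pi z = a) ->
    regular (link D [set x]) (W0 :\ y) (y |: C0).
  move=> yx d0 yW cC copy0; apply: (IHlink _ _ k').
  - exact: down_closed_link1.
  - move=> G /(facets_link1 downD)[/pureD]; rewrite cardsU1 => + xG.
    by rewrite xG kE => -[].
  - move=> a; rewrite inE in_link1 inE => /and3P[aD xa _].
    have [||z zW za] := copy0 a; rewrite ?inE // 1?eq_sym //.
    by exists z; rewrite // !inE zW andbT; apply: contraNneq xa => zy; rewrite -za zy yx.
  - exact: disjointU1D.
  - by rewrite cardsU1 (disjointFl d0) // cC -dE kE; lia.
have [m] := ubnP #|[set y in W | pi y == x]|; elim: m W dCW copyD => // m IHm W dCW copyD.
rewrite ltnS => sW.
have [y yW yx] := copyD x xD.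
apply: (@regular_step _ _ _ y) => //; first by rewrite yx; apply: linkC => // a aD _; apply: copyD.
have dCWy : [disjoint C & W :\ y] by apply: disjointWr dCW; apply: subD1set.
have copyWy a : a \in vertices D -> a != x -> exists2 z, z \in W :\ y & pi z = a.
  move=> aD ax; have [z zW za] := copyD a aD; exists z; rewrite // !inE zW andbT.
  by apply: contraNneq ax => zy; rewrite -za zy yx.
(* While another copy of [x] remains, removing [y] does not change [D]. *)
have [/exists_inP[z zW /eqP zx]|nz] := boolP [exists z in W :\ y, pi z == x].
  apply: IHm => // [a aD|].
    have [->|ax] := eqVneq a x; [by exists z|exact: copyWy].
  apply: leq_trans sW; apply: proper_card; apply/properP; split.
    by apply/subsetP => u; rewrite !inE => /andP[/andP[_ ->]].
  by exists y; rewrite !inE ?yW ?yx eqxx.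
(* The last copy of [x] is gone, so [D] gives way to its deletion, which is pure of the same size
   because its facets are facets of [D]. *)
rewrite (@partial_expansion_deletion _ _ _ _ _ _ x); last first.
  by move=> u uW; apply: contraNN nz => ux; apply/exists_inP; exists u.
apply: (IHdel _ _ k) => //.
- exact: down_closed_deletion.
- by move=> F /(subsetP sub)/pureD.
- move=> a; rewrite inE in_deletion1 inE => /andP[aD xa].
  by apply: copyWy; rewrite ?inE // eq_sym.
Qed.

End VertexDecomposableRegular.

(** * Stanley-Reisner rings *)

Section StanleyReisnerRing.
Variables (K : fieldType) (T : finType) (D : complex T).
Local Notation S := {mpoly K[#|T|]}.
Local Notation R := (SR_ring K D).
Local Notation X x := ('X_(enum_rank x) : S).
Local Open Scope quotient_scope.

Definition indicator (F : {set T}) : 'X_{1..#|T|} :=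
  [multinom ((enum_val i \in F) : nat) | i < #|T|].

Lemma support_indicator F : mon_support (indicator F) = F.
Proof. by apply/setP => x; rewrite inE mnmE enum_rankK; case: (x \in F). Qed.

Lemma face_monomialE F : face_monomial K F = 'X_[indicator F].
Proof.
rewrite mpolyXE_id /face_monomial (reindex (@enum_rank T)); last first.
  by apply: onW_bij; apply: enum_rank_bij.
rewrite big_mkcond; apply: eq_bigr => x _.
by rewrite mnmE enum_rankK; case: (x \in F).
Qed.

Lemma complex_down_closed : down_closed D.
Proof. by move=> F G; apply: complexS. Qed.

Lemma SR_ideal_nonface (p : S) : (p \in SR_ideal D) <-> nonface_ideal D p.
Proof.
split=> [/SR_idealP|Ip].
  apply: ideal_gen_min => [|_ /imageP[F FD ->]].
    exact: ideal_nonface complex_down_closed.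
  rewrite face_monomialE; apply/nonface_idealX.
  by rewrite support_indicator; rewrite inE in FD.
apply/SR_idealP; move: p Ip; apply: nonface_ideal_min; first exact: ideal_ideal_gen.
(* A monomial is divisible by the squarefree monomial of its support. *)
move=> m mD; have le_m : (indicator (mon_support m) <= m)%MM.
  apply/mnm_lepP => i; rewrite mnmE inE enum_valK; case: (m i) => //.
rewrite -(submK le_m) mpolyXD -face_monomialE.
apply: ideal_mull; first exact: ideal_ideal_gen.
by apply: mem_ideal_gen; apply: image_f; rewrite inE.
Qed.

Definition SR_map : {rmorphism S -> R} := \pi_R.

Lemma SR_map_surj z : exists p, SR_map p = z.
Proof. by elim/quotW: z => p; exists p. Qed.

Lemma SR_map_eq0 p : SR_map p = 0 <-> nonface_ideal D p.
Proof.
rewrite -(rmorph0 SR_map) -SR_ideal_nonface -[in Y in _ <-> Y](subr0 p).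
by rewrite Quotient.idealrBE; split=> /eqP.
Qed.

Lemma preimage_SR_map_zero : preimage SR_map (@zero_ideal R) = nonface_ideal D.
Proof. by apply/funext => p; apply/propext; apply: SR_map_eq0. Qed.

Lemma noetherian_SR : noetherian R.
Proof. exact: noetherian_surj SR_map_surj (@noetherian_mpoly K #|T|). Qed.

Lemma prime_prod (Q : R -> Prop) (J : Type) (r : seq J) (A : pred J) (f : J -> R) :
  prime_ideal Q -> Q (\prod_(j <- r | A j) f j) -> exists2 j, A j & Q (f j).
Proof.
move=> [_ Q1 QM]; elim: r => [|j r IH]; first by rewrite big_nil.
by rewrite big_cons; case: ifP => // Aj /QM[Qj|/IH //]; exists j.
Qed.

(** The variables outside [C 0] form a face: the product over a nonface is zero in the ring, and the
    prime [C 0] would contain one of its factors. *)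
Lemma SR_chain_length P h C : prime_chain_to P h C ->
  exists2 F, F \in D & (h <= #|F|)%N /\ forall x, x \in F -> ~ C 0%N (SR_map (X x)).
Proof.
move=> chain; have [Cprime _ _] := chain; have prime0 := Cprime 0%N isT.
have := prime_chain_length (preimage_chain SR_map_surj chain).
set V := [set i | _] => leh; pose F : {set T} := [set x | enum_rank x \in V].
exists F.
  apply: contrapT => /negP FD.
  have: C 0%N (SR_map (face_monomial K F)).
    have -> : SR_map (face_monomial K F) = 0.
      by apply/SR_map_eq0; rewrite face_monomialE; apply/nonface_idealX; rewrite support_indicator.
    by apply: ideal0; have [] := prime0.
  rewrite /face_monomial rmorph_prod => /(prime_prod prime0)[x].
  by rewrite !inE => /asboolP.
split; last by move=> x; rewrite !inE => /asboolP.
apply: leq_trans leh _; rewrite -(card_imset _ (@enum_val_inj T T)).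
by apply: subset_leq_card; apply/subsetP => _ /imsetP[i iV ->]; rewrite inE enum_valK.
Qed.

(** The residue field is generated over [K] by the images of the variables, so Zariski's lemma makes
    each of them integral over [K]. *)
Lemma SR_maximal_monic (P : R -> Prop) : maximal_ideal P ->
  forall x, exists h : {poly K}, h \is monic /\ P (SR_map (eval_at x h)).
Proof.
move=> /residue_field_exists[L [f [fsurj feq0]]] x.
pose fS : {rmorphism S -> L} := f \o SR_map.
pose g : {rmorphism K -> L} := fS \o @mpolyC #|T| K.
have [|h mon_h /rootP hx] := @zariski L K g (fS (X x)) [seq fS 'X_i | i <- enum 'I_#|T|].
  move=> y; have [z <-] := fsurj y; have [p <-] := SR_map_surj z.
  apply: (mpoly_generated (f := fS)) => // i.
  by rewrite inE; apply/orP; right; apply/mapP; exists i; rewrite ?mem_enum.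
exists h; split=> //; apply/feq0; rewrite -hx.
by rewrite [LHS](_ : _ = fS (eval_at x h)) // /eval_at -horner_map -map_poly_comp.
Qed.

(** With [h] adapted to [P], the sequence lies in [P] and yields a chain of length [d]. Every
    regular sequence in [P] yields a chain, and no chain is longer than a face, so depth and height
    both equal [d]. *)
Lemma cohen_macaulay_of_regular d :
  (forall h : T -> {poly K}, (forall x, h x \is monic) ->
     weakly_regular (nonface_ideal D) (elem_syms (parameter h) d)) ->
  (forall F, F \in D -> (#|F| <= d)%N) -> cohen_macaulay_over K D.
Proof.
move=> reg leD; split; first exact: noetherian_SR.
move=> P maxP; have primeP := maximal_prime maxP; have [hP P1 _] := primeP.
have /choice[h hP'] := SR_maximal_monic maxP.
have hmon x : h x \is monic by have [] := hP' x.
pose xs := map SR_map (elem_syms (parameter h) d).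
have xsP x : x \in xs -> P x.
  move=> /mapP[p pin ->]; apply: (mem_elem_syms (ideal_preimage SR_map hP) _ pin) => v.
  by rewrite /preimage rmorphM; apply: ideal_mull => //; have [] := hP' v.
have not_sat : ~ saturation P (@zero_ideal R) 1.
  by move=> [s Ps]; rewrite mulr1 => s0; apply: Ps; rewrite s0; apply: ideal0.
have chain_le k C : prime_chain_to P k C -> (k <= d)%N.
  by move=> /SR_chain_length[F /leD leFd [/leq_trans -> //]].
have chain_of ys : regular_sequence_in P ys -> exists C, prime_chain_to P (size ys) C.
  move=> [/regular_sequenceE[_ wys] ysP].
  have [C [chain _]] := regular_chain noetherian_SR primeP (@ideal_zero R) wys ysP not_sat.
  by exists C.
have regxs : regular_sequence_in P xs.
  split=> //; apply/regular_sequenceE; split; first by move/(ideal_gen_min hP xsP).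
  apply: weakly_regular_map; [exact: SR_map_surj|exact: ideal_zero|].
  by rewrite preimage_SR_map_zero; apply: reg.
have sxs : size xs = d by rewrite size_map size_elem_syms.
exists d; split; split.
- by exists xs.
- by move=> ys /chain_of[C /chain_le].
- by have := chain_of _ regxs; rewrite sxs.
- by [].
Qed.

(** * Primes of faces, and purity of Cohen-Macaulay complexes *)

Section FacePrimes.

(* The prime of R generated by the vertices outside F, when F is a face. *)
Definition face_prime (F : {set T}) (z : R) :=
  exists2 p, SR_map p = z & nonface_ideal (powerset F) p.

Let hF F : ideal (@nonface_ideal K T (powerset F)).
Proof.
by apply: ideal_nonface => A B; rewrite !powersetE => AF BA; apply: subset_trans AF.
Qed.

Lemma face_primeE F p : F \in D ->
  face_prime F (SR_map p) <-> nonface_ideal (powerset F) p.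
Proof.
move=> FD; split=> [[q E Iq]|]; last by exists p.
suff : nonface_ideal (powerset F) (q - p).
  by move/(idealB (hF F) Iq); rewrite opprB addrC subrK.
have /SR_map_eq0 Ipq : SR_map (q - p) = 0 by rewrite rmorphB E subrr.
move=> m; rewrite powersetE => mF; apply: Ipq; exact: complexS mF.
Qed.

(** Sets the variables outside [F] to zero. Its kernel is the ideal of the simplex [F], which is
    therefore prime, the polynomial ring being a domain. *)
Definition restrict (F : {set T}) : {rmorphism S -> S} :=
  mmap (@mpolyC #|T| K) (fun i => if enum_val i \in F then 'X_i : S else 0).

Lemma restrictX F m : restrict F 'X_[m] = if mon_support m \subset F then 'X_[m] else 0.
Proof.
rewrite /restrict /= mmapX /mmap1; case: ifP => [mF|/negbT/subsetPn[x xm xF]].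
  rewrite [RHS]mpolyXE_id; apply: eq_bigr => i _; case: ifPn => // iF.
  suff -> : m i = 0%N by rewrite !expr0.
  apply/eqP; apply: contraNT iF => mi; apply: (subsetP mF).
  by rewrite inE enum_valK.
rewrite (bigD1 (enum_rank x)) //= enum_rankK (negbTE xF) expr0n.
by rewrite inE in xm; rewrite (negbTE xm) mul0r.
Qed.

Lemma mcoeff_restrict F p m :
  (restrict F p)@_m = if mon_support m \subset F then p@_m else 0.
Proof.
rewrite {1}(mpolyE p) rmorph_sum raddf_sum /=.
have -> : (if mon_support m \subset F then p@_m else 0) =
    \sum_(k <- msupp p) (p@_k *: (if mon_support k \subset F then 'X_[k] else 0 : S))@_m.
  case: ifP => mF; last first.
    rewrite big1 // => k _; rewrite mcoeffZ; case: ifP => kF; rewrite ?mcoeff0 ?mulr0 //.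
    rewrite mcoeffX; case: eqP => [E|_]; rewrite ?mulr0 //.
    by rewrite -E kF in mF.
  rewrite {1}(mpolyE p) raddf_sum; apply: eq_bigr => k _ /=; rewrite !mcoeffZ; congr (_ * _).
  by rewrite mcoeffX; case: eqP => [->|nE]; [rewrite mF mcoeffX eqxx|
     case: ifP => _; rewrite ?mcoeff0 // mcoeffX; case: eqP].
apply: eq_bigr => k _; rewrite -mul_mpolyC rmorphM restrictX.
by rewrite [restrict F _]mmapC mul_mpolyC.
Qed.

Lemma nonface_powerset_restrict F p : nonface_ideal (powerset F) p <-> restrict F p = 0.
Proof.
split=> [Ip|p0 m].
  by apply/mpolyP => m; rewrite mcoeff_restrict mcoeff0; case: ifP => // mF; rewrite Ip ?powersetE.
by rewrite powersetE => mF; have := mcoeff_restrict F p m; rewrite p0 mF mcoeff0.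
Qed.

Lemma prime_face F : F \in D -> prime_ideal (face_prime F).
Proof.
move=> FD; split.
- split; first by rewrite -(rmorph0 SR_map); exact/(face_primeE _ FD)/(ideal0 (hF F)).
    by move=> _ _ [p <- Ip] [q <- Iq]; rewrite -rmorphD; apply/(face_primeE _ FD)/(idealD (hF F)).
  move=> z _ [p <- Ip]; have [q <-] := SR_map_surj z.
  by rewrite -rmorphM; apply/(face_primeE _ FD)/(ideal_mull (hF F)).
- rewrite -(rmorph1 SR_map) => /(face_primeE _ FD)/nonface_powerset_restrict.
  by rewrite rmorph1 => /eqP; rewrite oner_eq0.
- move=> x y; have [p <-] := SR_map_surj x; have [q <-] := SR_map_surj y.
  rewrite -rmorphM => /(face_primeE _ FD)/nonface_powerset_restrict.
  rewrite rmorphM => /eqP; rewrite mulf_eq0 => /orP[] /eqP /nonface_powerset_restrict E.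
    by left; apply/face_primeE.
  by right; apply/face_primeE.
Qed.

Lemma face_prime_vertex F x : F \in D -> face_prime F (SR_map (X x)) <-> x \notin F.
Proof.
move=> FD; rewrite face_primeE // (nonface_idealX K) supportU powersetE sub1set.
by [].
Qed.

Lemma face_primeS (F G : {set T}) : F \in D -> G \subset F -> subideal (face_prime F) (face_prime G).
Proof.
move=> FD GF _ [p <- Ip]; exists p => // m; rewrite powersetE => mG.
by apply: Ip; rewrite powersetE; apply: subset_trans GF.
Qed.

Lemma face_prime0 p : face_prime set0 (SR_map p) <-> p@_0%MM = 0.
Proof.
rewrite face_primeE ?complex0 //; split=> [Ip|p0 m].
  by apply: Ip; rewrite powersetE; apply/subsetP => x; rewrite inE mnm0E.
rewrite powersetE subset0 => /eqP m0; suff -> : m = 0%MM by [].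
apply/mnmP => i; rewrite mnm0E; apply/eqP; apply: contraT => mi.
have : enum_val i \in mon_support m by rewrite inE enum_valK.
by rewrite m0 inE.
Qed.

Lemma maximal_face_prime0 : maximal_ideal (face_prime set0).
Proof.
have [hm m1 _] := prime_face (complex0 D); split=> // J hJ J1 mJ z.
have [p <-] := SR_map_surj z => Jp; apply/face_prime0.
apply/eqP; apply: contrapT => /negP p0; apply: J1.
have Jc : J (SR_map (p@_0%MM)%:MP).
  have -> : (p@_0%MM)%:MP = p - (p - (p@_0%MM)%:MP) by ring.
  rewrite rmorphB; apply: idealB => //; apply: mJ; apply/face_prime0.
  by rewrite mcoeffB mcoeffC eqxx mulr1 subrr.
rewrite -(rmorph1 SR_map) -(rmorph1 (@mpolyC #|T| K)) -(mulVf p0) !rmorphM.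
exact: ideal_mull.
Qed.

(** Points of [F] are dropped one at a time, and the variable of the dropped point enters the next
    prime. *)
Lemma face_chain F : F \in D ->
  exists C, prime_chain_to (face_prime set0) #|F| C.
Proof.
move=> FD; pose G i := [set x in drop i (enum F)].
have GD i : G i \in D.
  by apply: complexS FD _; apply/subsetP => x; rewrite inE => /mem_drop; rewrite mem_enum.
exists (fun i => face_prime (G i)); split=> [i _|i|x]; first exact: prime_face.
  rewrite cardE => lti; have GS : G i.+1 \subset G i.
    by apply/subsetP => x; rewrite !inE -add1n -drop_drop => /mem_drop.
  split; first exact: face_primeS.
  have x0 : T by move: lti; case: (enum F).
  pose x := nth x0 (enum F) i; move/(_ (SR_map (X x))).
  have dropE : drop i (enum F) = x :: drop i.+1 (enum F) by rewrite (drop_nth x0).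
  have : uniq (drop i (enum F)) by rewrite drop_uniq ?enum_uniq.
  rewrite dropE /= => /andP[xn _].
  rewrite !face_prime_vertex // !inE dropE inE eqxx /=.
  by move/(_ xn).
suff -> : G #|F| = set0 by [].
by apply/setP => y; rewrite !inE drop_oversize // cardE.
Qed.

(** At the irrelevant ideal, height is at least [#|F'|]. The variables outside the facet [F]
    annihilate its face monomial, so a longest regular sequence gives a chain whose first prime
    contains them, of length at most [#|F|]. *)
Lemma cohen_macaulay_facets F F' : cohen_macaulay_over K D ->
  F \in facets D -> F' \in facets D -> (#|F'| <= #|F|)%N.
Proof.
move=> [noeth CM] /facetP[FD maxF] /facetP[FD' _].
have [d [[[xs regxs sxs] _] [_ height_le]]] := CM _ maximal_face_prime0.
have [C0 /height_le lef] := face_chain FD'.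
apply: leq_trans lef _; have primeM := prime_face (complex0 D).
move: regxs => [/regular_sequenceE[_ wxs] xsM].
pose a := SR_map (face_monomial K F).
(* If [p] has nonzero constant term, its product with the monomial of [F] has this constant as
   coefficient at a face, hence is nonzero in the ring. *)
have na : ~ saturation (face_prime set0) (@zero_ideal R) a.
  move=> [s]; have [p <-] := SR_map_surj s; rewrite face_prime0 => p0.
  rewrite /zero_ideal -rmorphM => /SR_map_eq0/(_ (indicator F)).
  rewrite support_indicator => /(_ FD).
  by rewrite face_monomialE -[Y in _@_Y]addm0 mcoeffMX => /p0.
have [C [chain aC]] := regular_chain noeth primeM (@ideal_zero R) wxs xsM na.
have [G GD [leG GC]] := SR_chain_length chain.
rewrite -sxs; apply: leq_trans leG _; apply: subset_leq_card.
apply/subsetP => x /GC nCx; apply: contraT => xF; case: nCx; apply: aC.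
apply: sub_saturation => //; rewrite /zero_ideal -rmorphM; apply/SR_map_eq0.
rewrite face_monomialE -mpolyXD; apply/nonface_idealX.
rewrite supportD supportU support_indicator; apply: contraNN xF => xFD.
by rewrite -(maxF _ xFD (subsetUr _ _)) setU11.
Qed.

End FacePrimes.
End StanleyReisnerRing.

(** * Expansions of pure complexes *)

Section PureExpansions.
Variables (T : finType) (D : complex T).

(** Lying in a facet of the expansion means projecting injectively onto a face: the choice [r] reads
    off the copy present in [G], and takes the first copy at points with none. *)
Lemma expansion_facesE (s : T -> nat) : (forall i, 0 < s i)%N ->
  expansion_faces D s = partial_expansion (@tag T (fun i => 'I_(s i))) D setT set0.
Proof.
move=> s_gt0; apply/setP => G; rewrite !inE setD0 subsetT /=.
apply/exists_inP/andP => [[_ /[!inE] /exists_inP[F /facetP[FD _] /existsP[r /eqP->]] GF]|].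
  have sGF : tag @: G \subset F.
    by apply/subsetP => _ /imsetP[y /(subsetP GF)/imsetP[i iF ->] ->].
  split; last exact: complexS sGF.
  apply/imset_injP => _ _ /(subsetP GF)/imsetP[i _ ->] /(subsetP GF)/imsetP[j _ ->] /=.
  by move=> ->.
case=> /imset_injP injG GD; have [F FD GF] := facet_exists GD.
have [r rP] : exists r : forall i, 'I_(s i), forall i y, y \in G -> tag y = i ->
    y = Tagged (fun i => 'I_(s i)) (r i).
  apply: (@fin_all_exists _ _ (fun i a => forall y, y \in G -> tag y = i ->
    y = Tagged (fun i => 'I_(s i)) a)) => i.
  have [/imsetP[[j a] jG ->]|nG] := boolP (i \in tag @: G).
    by exists a => y yG yj; apply: injG.
  exists (Ordinal (s_gt0 i)) => y yG yi; case/negP: nG.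
  by rewrite -yi imset_f.
exists [set Tagged (fun i => 'I_(s i)) ([ffun i => r i] i) | i in F].
  rewrite inE; apply/exists_inP; exists F => //.
  by apply/existsP; exists [ffun i => r i].
apply/subsetP => y yG; apply/imsetP; exists (tag y).
  by rewrite (subsetP GF) ?imset_f.
by rewrite ffunE; apply: rP.
Qed.

(** Lets one theorem treat [D] itself along with its expansions. *)
Lemma partial_expansion_id : partial_expansion id D setT set0 = D.
Proof.
by apply/setP => G; rewrite !inE setD0 subsetT imset_id eqxx.
Qed.

(** The image of [F] under a section of [pi] is such a facet; through it, purity of an expansion
    descends to [D]. *)
Lemma facet_partial_expansion (T' : finType) (pi : T' -> T) (F : {set T}) :
  (forall a, exists y, pi y = a) -> F \in facets D ->
  exists2 G, G \in facets (partial_expansion pi D setT set0) & #|G| = #|F|.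
Proof.
move=> /fin_all_exists[g gK] /facetP[FD maxF].
have imF : pi @: (g @: F) = F.
  by rewrite -imset_comp -[RHS]imset_id; apply: eq_imset => a /=.
have cF : #|g @: F| = #|F| by rewrite card_imset //; apply: can_inj gK.
exists (g @: F) => //; apply/facetP.
split=> [|H]; first by rewrite inE setD0 subsetT imF cF eqxx.
rewrite inE setD0 subsetT /= => /andP[/eqP cH HD] FH.
apply/eqP; rewrite eq_sym eqEcard FH -cH cF.
suff FpiH : F \subset pi @: H by rewrite (maxF _ HD FpiH) leqnn.
by have := imsetS pi FH; rewrite imF.
Qed.

Lemma cohen_macaulay_partial_expansion (K : fieldType) (T' : finType) (pi : T' -> T)
  (D' : complex T') k :
  faces D' = partial_expansion pi D setT set0 -> (forall a, exists y, pi y = a) ->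
  vertex_decomposable D -> (forall F, F \in facets D -> #|F| = k) ->
  cohen_macaulay_over K D'.
Proof.
move=> D'E pi_surj vdD pureD; apply: (@cohen_macaulay_of_regular _ _ _ k).
  move=> h h_monic; rewrite D'E.
  apply: (regular_vertex_decomposable h_monic vdD (@complex_down_closed _ D) pureD).
  - by move=> a _; have [y ya] := pi_surj a; exists y.
  - by rewrite -setI_eq0 set0I.
  - by rewrite cards0.
move=> G; rewrite D'E inE setD0 => /and3P[_ /eqP <- GD].
by have [F /pureD <- GF] := facet_exists GD; apply: subset_leq_card.
Qed.

End PureExpansions.

Theorem corollary2p10 (K : fieldType) (n : nat) (D : complex 'I_n)
  (vertD : vertices D = [set: 'I_n]) (vdD : vertex_decomposable D)
  (s : 'I_n -> nat) (s_gt0 : forall i : 'I_n, (0 < s i)%N) :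
  cohen_macaulay_over K D <-> cohen_macaulay_over K (expansion D s_gt0).
Proof.
have expE := expansion_facesE D s_gt0.
have tag_surj i : exists y : {i : 'I_n & 'I_(s i)}, tag y = i.
  by exists (Tagged (fun i => 'I_(s i)) (Ordinal (s_gt0 i))).
have [F0 F0D _] := facet_exists (complex0 D).
split=> CM.
  apply: (cohen_macaulay_partial_expansion (D := D) (D' := expansion D s_gt0) (k := #|F0|) K
    expE) => // F FD.
  by apply/eqP; rewrite eqn_leq !(cohen_macaulay_facets CM).
apply: (cohen_macaulay_partial_expansion (D := D) (k := #|F0|) (pi := id) K) => //.
- by rewrite partial_expansion_id.
- by move=> i; exists i.
(* Facets of [D] are compared through facets of the expansion of the same sizes, where the
   Cohen-Macaulay hypothesis applies. *)
move=> F FD; have [G GD <-] := facet_partial_expansion tag_surj FD.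
have [G0 G0D <-] := facet_partial_expansion tag_surj F0D.
rewrite -expE in GD G0D.
by apply/eqP; rewrite eqn_leq !(cohen_macaulay_facets CM).
Qed.
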